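(* Let $g \geq 2$ and $\varphi \in \mathcal{A}_1$. Then $\det(r^{\mathcal{A},\mathfrak{a}}(\varphi)) \in H' \subset \mathbb{Z}[H']$ and $$\det(r^{\mathcal{A},\mathfrak{a}}(\varphi)) = \operatorname{Tr}^A_1(\tau_1(\varphi)),$$ as elements of $H'$. Consequently, for every $k \geq 2$, the determinant of the Magnus representation $r^{\mathcal{A},\mathfrak{a}}$ is trivial on $\mathcal{A}_k$, i.e. $\det(r^{\mathcal{A},\mathfrak{a}}(\varphi)) = 1$ in $\mathbb{Z}[H']$ for every $\varphi \in \mathcal{A}_k$.
   Context: Let $\Sigma = \Sigma_{g,1}$ be a compact connected oriented surface of genus $g$ with one boundary component, and let $\mathcal{M}$ be its mapping class group (relative to the boundary). Let $V_g$ be a genus $g$ handlebody whose boundary minus a disk is identified with $\Sigma$. The handlebody group $\mathcal{A} \subset \mathcal{M}$ is the subgroup of mapping classes that extend to $V_g$. Put $\pi = \pi_1(\Sigma)$ (base point on $\partial\Sigma$; free of rank $2g$), $\pi' = \pi_1(V_g)$ (free of rank $g$), $H = H_1(\Sigma;\mathbb{Z})$, $H' = H_1(V_g;\mathbb{Z})$. Let $\mathbb{A} = \ker(\pi \to \pi')$ and $A = \ker(H \to H')$, the maps being induced by $\Sigma \subset V_g$. The group $\mathcal{A}$ coincides with the subgroup of $\mathcal{M}$ preserving $\mathbb{A}$; hence $\mathcal{A}$ acts on $\pi'$ and $H'$. Fix a basis $(\alpha_1,\dots,\alpha_g,\beta_1,\dots,\beta_g)$ of the free group $\pi$ that induces a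 symplectic basis of $H$, such that $\mathbb{A}$ is normally generated by the $\alpha_i$ and the images $\beta_i'$ of the $\beta_i$ in $\pi'$ form a basis of the free group $\pi'$. The intersection form of $\Sigma$ is a symplectic form $\omega : H \otimes H \to \mathbb{Z}$, and $H$ is identified with $H^* = \operatorname{Hom}(H,\mathbb{Z})$ via $x \mapsto \omega(x,-)$. The subgroup $A$ is Lagrangian and $\omega$ induces a perfect pairing $\omega' : A \otimes H' \to \mathbb{Z}$, which identifies $A$ with $(H')^*$. Magnus representation of the handlebody group: let $\frac{\partial}{\partial \beta_i'} : \mathbb{Z}[\pi'] \to \mathbb{Z}[\pi']$ be the Fox derivatives with respect to the basis $(\beta_i')$, i.e. the $\mathbb{Z}$-linear maps with $\frac{\partial \beta_j'}{\partial \beta_i'} = \delta_{i,j}$ and $\frac{\partial (uv)}{\partial \beta_i'} = \frac{\partial u}{\partial \beta_i'} + u \frac{\partial v}{\partial \beta_i'}$ for $u,v \in \pi'$. For $x \in \mathbb{Z}[\pi']$, let $\overline{x}$ be its image under the anti-automorphism induced by inversion in $\pi'$. Define $$r^{\mathcal{A}} : \mathcal{A} \to \operatorname{GL}(g,\mathbb{Z}[\pi']), \quad \varphi \mapsto \left(\overline{\frac{\partial \varphi(\beta_j')}{\partial \beta_i'}}\right)_{1\le i,j\le g},$$ and let $r^{\mathcal{A},\mathfrak{a}} : \mathcal{A} \to \operatorname{GL}(g,\mathbb{Z}[H'])$ be obtained by applying the abelianization map $\mathbb{Z}[\pi'] \to \mathbb{Z}[H']$ to the entries. Elements of $H'$ are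 regarded as group elements in the group ring $\mathbb{Z}[H']$ (multiplicative notation), while $H'$ is written additively when it is the target of $\operatorname{Tr}^A_1$. For an abelian group $M$, let $T(M)$ be the tensor algebra, $\mathcal{L}(M) = \bigoplus_k \mathcal{L}_k(M)$ the free graded Lie ring on $M$ (embedded in $T(M)$ by $[a,b] = a\otimes b - b\otimes a$). Let $\Gamma_1\pi = \pi$, $\Gamma_{k+1}\pi = [\pi, \Gamma_k\pi]$; $\Gamma_k\pi/\Gamma_{k+1}\pi \simeq \mathcal{L}_k(H)$. For $k\ge 1$, $J_k \subset \mathcal{M}$ is the subgroup of elements acting trivially on $\pi/\Gamma_{k+1}\pi$ (so $J_1$ is the Torelli group), and $\mathcal{A}_k = \mathcal{A} \cap J_k$. The first Johnson homomorphism $\tau_1 : J_1 \to \operatorname{Hom}(H, \mathcal{L}_2(H)) \simeq H^*\otimes\mathcal{L}_2(H) \simeq H \otimes \mathcal{L}_2(H)$ sends $\varphi$ to the map $\{x\} \mapsto \{\varphi(x)x^{-1}\} \in \Gamma_2\pi/\Gamma_3\pi$. It takes values in $D_1(H) = \ker\big([\,,\,] : H \otimes \mathcal{L}_2(H) \to \mathcal{L}_3(H)\big)$. Let $D_1(H') = \ker\big(H' \otimes \mathcal{L}_2(H') \to \mathcal{L}_3(H')\big)$, and let $\mathcal{G}_1$ be the kernel of the natural projection $D_1(H) \to D_1(H')$. It is known that $\tau_1(\mathcal{A}_1) \subset \mathcal{G}_1$. The image of an element of $\mathcal{G}_1$ in $H \otimes \mathcal{L}_2(H')$ lies in $A \otimes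 \mathcal{L}_2(H') = \ker\big(H\otimes\mathcal{L}_2(H') \to H'\otimes\mathcal{L}_2(H')\big)$. The Lagrangian trace $\operatorname{Tr}^A_1 : \mathcal{G}_1 \to S^1(H') = H'$ is the composition $$\mathcal{G}_1 \to A \otimes \mathcal{L}_2(H') \hookrightarrow A \otimes H' \otimes H' \to H',$$ where the last map contracts the first two factors: $a \otimes h_1 \otimes h_2 \mapsto \omega'(a,h_1)\, h_2$. *)

(* Defs.v *)
From HB Require Import structures.
From mathcomp Require Import monalg.
From mathcomp Require Import all_boot all_order all_algebra generic_quotient.
From mathcomp Require Import finmap lra.
From mathcomp Require Import boolp classical_sets functions reals topology normedtype.

Set Implicit Arguments.
Unset Strict Implicit.
Unset Printing Implicit Defensive.

Import Order.TTheory GRing.Theory Num.Theory.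
Import numFieldNormedType.Exports.

Local Open Scope classical_set_scope.
Local Open Scope quotient_scope.
Local Open Scope ring_scope.

Section Groups.
Local Open Scope group_scope.

Inductive generated (G : groupType) (X : set G) : set G :=
| generated1 : generated X 1
| generated_in x : X x -> generated X x
| generatedM x y : generated X x -> generated X y -> generated X (x * y)
| generatedV x : generated X x -> generated X x^-1.

Definition normal_closure (G : groupType) (X : set G) : set G :=
  generated [set x ^ y | x in X & y in setT].

(* The value at 0 is irrelevant; the series starts at index 1. *)
Fixpoint lower_central (G : groupType) (k : nat) : set G :=
  match k with
  | 0 => setT
  | k'.+1 => match k' with
             | 0 => setT
             | _ => generated [set [~ x, y] | x in setT & y in @lower_central G k']
             end
  end.

Arguments lower_central : clear implicits.

Definition free_basis (G : groupType) (I : Type) (b : I -> G) : Prop :=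
  forall (K : groupType) (f : I -> K),
    (exists h : {multiplicative G -> K}, forall i, h (b i) = f i) /\
    (forall h h' : {multiplicative G -> K},
        (forall i, h (b i) = h' (b i)) -> h =1 h').

Section Abelianization.
Variable G : groupType.

Definition abel_rel : rel G := fun x y => `[< lower_central G 2 (x * y^-1) >].

Lemma lcs2J (x y : G) : lower_central G 2 x -> lower_central G 2 (x ^ y).
Proof.
move=> hx; rewrite -[x ^ y](mulVKg x).
by apply: generatedM => //; apply: generated_in; exists x => //; exists y.
Qed.

Lemma lcs2C (x y : G) : lower_central G 2 (x * y) -> lower_central G 2 (y * x).
Proof. by move=> /(@lcs2J _ x); rewrite conjgE !mulgA mulVg mul1g. Qed.

Lemma abel_rel_refl : reflexive abel_rel.
Proof. by move=> x; apply/asboolP; rewrite mulgV; exact: generated1. Qed.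

Lemma abel_rel_sym : symmetric abel_rel.
Proof.
by move=> x y; apply/asboolP/asboolP => /generatedV; rewrite invgM invgK.
Qed.

Lemma abel_rel_trans : transitive abel_rel.
Proof.
move=> y x z /asboolP h1 /asboolP h2; apply/asboolP.
by have := generatedM h1 h2; rewrite mulgA mulgVK.
Qed.

Canonical abel_equiv := EquivRel abel_rel abel_rel_refl abel_rel_sym abel_rel_trans.

Definition abel := {eq_quot abel_rel}.
HB.instance Definition _ := Choice.on abel.

Definition ab (x : G) : abel := \pi_abel x.

Lemma ab_eqP x y : reflect (lower_central G 2 (x * y^-1)) (ab x == ab y).
Proof. by rewrite /ab eqmodE; exact: asboolP. Qed.

Lemma ab_eq x y : lower_central G 2 (x * y^-1) -> ab x = ab y.
Proof. by move=> h; apply/eqP/ab_eqP. Qed.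

Lemma ab_repr (a : abel) : ab (repr a) = a.
Proof. exact: reprK. Qed.

Lemma ab_surj (a : abel) : exists x, a = ab x.
Proof. by exists (repr a); rewrite ab_repr. Qed.

Definition abel_add (a b : abel) : abel := ab (repr a * repr b).
Definition abel_opp (a : abel) : abel := ab (repr a)^-1.

Lemma ab_repr_rel x : lower_central G 2 (repr (ab x) * x^-1).
Proof. by apply/ab_eqP; rewrite ab_repr. Qed.

Lemma ab_add x y : abel_add (ab x) (ab y) = ab (x * y).
Proof.
apply: ab_eq; rewrite invgM.
have hx := ab_repr_rel x; have hy := ab_repr_rel y.
apply: lcs2C; rewrite -!mulgA; apply: lcs2C; rewrite -!mulgA.
have := generatedM (lcs2C hx) hy.
by rewrite !mulgA.
Qed.

Lemma ab_opp x : abel_opp (ab x) = ab x^-1.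
Proof.
apply: ab_eq; rewrite invgK; apply: lcs2C.
have := generatedV (ab_repr_rel x); rewrite invgM invgK.
by [].
Qed.

Lemma abel_addA : associative abel_add.
Proof.
move=> a b c; have [x ->] := ab_surj a; have [y ->] := ab_surj b; have [z ->] := ab_surj c.
by rewrite !ab_add mulgA.
Qed.

Lemma abel_addC : commutative abel_add.
Proof.
move=> a b; have [x ->] := ab_surj a; have [y ->] := ab_surj b; rewrite !ab_add; apply: ab_eq.
apply: generated_in => /=; exists x^-1; first by [].
exists y^-1; first by [].
by rewrite /commg !invgK invgM !mulgA !invgK.
Qed.

Lemma abel_add0 : left_id (ab 1) abel_add.
Proof. by move=> a; have [x ->] := ab_surj a; rewrite ab_add mul1g. Qed.

Lemma abel_addN : left_inverse (ab 1) abel_opp abel_add.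
Proof. by move=> a; have [x ->] := ab_surj a; rewrite ab_opp ab_add mulVg. Qed.

HB.instance Definition _ :=
  GRing.isZmodule.Build abel abel_addA abel_addC abel_add0 abel_addN.

Lemma abM x y : ab (x * y) = (ab x + ab y)%R.
Proof. by rewrite -ab_add. Qed.

End Abelianization.

Section AbelMap.
Variables (G K : groupType) (f : {multiplicative G -> K}).

Definition abel_map (a : abel G) : abel K := ab (f (repr a)).

Lemma gmulf_one : f 1 = 1.
Proof. by apply: (@mulgI _ (f 1)); rewrite -gmulfM !mulg1. Qed.

Lemma gmulf_inv x : f x^-1 = (f x)^-1.
Proof. by apply: (@mulgI _ (f x)); rewrite -gmulfM !mulgV gmulf_one. Qed.

Lemma lcs2_morph x : lower_central G 2 x -> lower_central K 2 (f x).
Proof.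
elim=> [|_ [y _ [z _ <-]]|y z _ hy _ hz|y _ hy].
- by rewrite gmulf_one; exact: generated1.
- apply: generated_in; exists (f y); first by [].
  by exists (f z); rewrite // /commg !gmulfM !gmulf_inv.
- by rewrite gmulfM; exact: generatedM.
- by rewrite gmulf_inv; exact: generatedV.
Qed.

Lemma abel_mapE x : abel_map (ab x) = ab (f x).
Proof.
apply: ab_eq; rewrite -gmulf_inv -gmulfM.
by apply: lcs2_morph; exact: ab_repr_rel.
Qed.

Lemma abel_map_additive : {morph abel_map : a b / (a - b)%R}.
Proof.
move=> a b; have [x ->] := ab_surj a; have [y ->] := ab_surj b.
rewrite [in LHS](_ : (ab x - ab y)%R = ab (x * y^-1)); last first.
  by rewrite abM; congr (_ + _)%R; exact: ab_opp.
rewrite !abel_mapE gmulfM gmulf_inv abM.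
by congr (_ + _)%R; rewrite -ab_opp.
Qed.

HB.instance Definition _ :=
  GRing.isZmodMorphism.Build (abel G) (abel K) abel_map abel_map_additive.

End AbelMap.
End Groups.

Arguments lower_central : clear implicits.

Section Kernel.
Variables (M N : zmodType) (f : {additive M -> N}).

Definition kernel_pred : {pred M} := fun x => f x == 0.

Lemma kernel_zmod_closed : zmod_closed kernel_pred.
Proof.
split=> [|x y]; rewrite !unfold_in ?raddf0 // => /eqP hx /eqP hy.
by rewrite raddfB hx hy subrr.
Qed.

HB.instance Definition _ := GRing.isZmodClosed.Build M kernel_pred kernel_zmod_closed.

Record kernel := Kernel { kernel_val :> M; _ : kernel_val \in kernel_pred }.
HB.instance Definition _ := [isSub for kernel_val].
HB.instance Definition _ := [Choice of kernel by <:].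
HB.instance Definition _ := [SubChoice_isSubZmodule of kernel by <:].

End Kernel.

Definition biadditive (M N P : zmodType) (b : M -> N -> P) : Prop :=
  (forall n, {morph b^~ n : x y / x + y}) /\ (forall m, {morph b m : x y / x + y}).

(* The tensor product of M and N: formal sums of pairs (the sum of s is
   \sum_(u <- s) u.1 (x) u.2; no signs are needed as -(m (x) n) = (-m) (x) n),
   two of them being identified when no biadditive map separates them. *)
Section Tensor.
Variables M N : zmodType.

Definition tens_eval (P : zmodType) (b : M -> N -> P) (s : seq (M * N)) : P :=
  \sum_(u <- s) b u.1 u.2.

Definition tens_rel : rel (seq (M * N)) := fun s t =>
  `[< forall (P : zmodType) (b : M -> N -> P),
        biadditive b -> tens_eval b s = tens_eval b t >].

Lemma tens_rel_refl : reflexive tens_rel.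
Proof. by move=> s; apply/asboolP. Qed.

Lemma tens_rel_sym : symmetric tens_rel.
Proof. by move=> s t; apply/asboolP/asboolP => h P b /h. Qed.

Lemma tens_rel_trans : transitive tens_rel.
Proof.
by move=> t s u /asboolP h1 /asboolP h2; apply/asboolP => P b hb; rewrite h1 ?h2.
Qed.

Canonical tens_equiv := EquivRel tens_rel tens_rel_refl tens_rel_sym tens_rel_trans.

Definition tensor := {eq_quot tens_rel}.
HB.instance Definition _ := Choice.on tensor.

Definition tens_class (s : seq (M * N)) : tensor := \pi_tensor s.

Definition tens (m : M) (n : N) : tensor := tens_class [:: (m, n)].

(* The additive map induced by b, provided b is biadditive. *)
Definition tens_lift (P : zmodType) (b : M -> N -> P) (x : tensor) : P :=
  tens_eval b (repr x).

Lemma tens_classP s t :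
  (forall (P : zmodType) (b : M -> N -> P),
     biadditive b -> tens_eval b s = tens_eval b t) ->
  tens_class s = tens_class t.
Proof. by move=> h; apply/eqP; rewrite eqmodE; apply/asboolP. Qed.

Lemma tens_liftE (P : zmodType) (b : M -> N -> P) s :
  biadditive b -> tens_lift b (tens_class s) = tens_eval b s.
Proof.
have : tens_rel (repr (tens_class s)) s by rewrite -eqmodE reprK.
by move=> /asboolP h /h.
Qed.

Lemma tens_surj (x : tensor) : exists s, x = tens_class s.
Proof. by exists (repr x); rewrite /tens_class reprK. Qed.

Lemma biadditiveN (P : zmodType) (b : M -> N -> P) m n :
  biadditive b -> b (- m) n = - b m n.
Proof.
move=> [h _]; have h0 : b 0 n = 0.
  by apply: (@addrI _ (b 0 n)); rewrite -h !addr0.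
by apply: (@addrI _ (b m n)); rewrite -h !subrr h0.
Qed.

Definition tens_neg (s : seq (M * N)) := [seq (- u.1, u.2) | u <- s].

Lemma tens_eval_cat (P : zmodType) (b : M -> N -> P) s t :
  tens_eval b (s ++ t) = tens_eval b s + tens_eval b t.
Proof. by rewrite /tens_eval big_cat. Qed.

Lemma tens_eval_neg (P : zmodType) (b : M -> N -> P) s :
  biadditive b -> tens_eval b (tens_neg s) = - tens_eval b s.
Proof.
move=> hb; rewrite /tens_eval big_map -sumrN; apply: eq_bigr => u _.
exact: biadditiveN.
Qed.

Definition tens_add (x y : tensor) := tens_class (repr x ++ repr y).
Definition tens_opp (x : tensor) := tens_class (tens_neg (repr x)).

Lemma tens_addE s t : tens_add (tens_class s) (tens_class t) = tens_class (s ++ t).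
Proof.
apply: tens_classP => P b hb; rewrite !tens_eval_cat.
by rewrite -/(tens_lift b _) -/(tens_lift b _) !tens_liftE.
Qed.

Lemma tens_oppE s : tens_opp (tens_class s) = tens_class (tens_neg s).
Proof.
apply: tens_classP => P b hb; rewrite !tens_eval_neg //.
by rewrite -/(tens_lift b _) tens_liftE.
Qed.

Lemma tens_addA : associative tens_add.
Proof.
move=> x y z; have [s ->] := tens_surj x; have [t ->] := tens_surj y.
by have [u ->] := tens_surj z; rewrite !tens_addE catA.
Qed.

Lemma tens_addC : commutative tens_add.
Proof.
move=> x y; have [s ->] := tens_surj x; have [t ->] := tens_surj y.
by rewrite !tens_addE; apply: tens_classP => P b _; rewrite !tens_eval_cat addrC.
Qed.

Lemma tens_add0 : left_id (tens_class [::]) tens_add.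
Proof. by move=> x; have [s ->] := tens_surj x; rewrite tens_addE. Qed.

Lemma tens_addN : left_inverse (tens_class [::]) tens_opp tens_add.
Proof.
move=> x; have [s ->] := tens_surj x; rewrite tens_oppE tens_addE.
apply: tens_classP => P b hb; rewrite tens_eval_cat tens_eval_neg // addNr.
by rewrite /tens_eval big_nil.
Qed.

HB.instance Definition _ :=
  GRing.isZmodule.Build tensor tens_addA tens_addC tens_add0 tens_addN.

Lemma tens_class_cat s t : tens_class (s ++ t) = tens_class s + tens_class t.
Proof. by rewrite -tens_addE. Qed.

Lemma tens_liftD (P : zmodType) (b : M -> N -> P) :
  biadditive b -> {morph tens_lift b : x y / x + y}.
Proof.
move=> hb x y; have [s ->] := tens_surj x; have [t ->] := tens_surj y.
by rewrite -tens_class_cat !tens_liftE // tens_eval_cat.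
Qed.

Lemma tens_lift_tens (P : zmodType) (b : M -> N -> P) m n :
  biadditive b -> tens_lift b (tens m n) = b m n.
Proof. by move=> hb; rewrite tens_liftE // /tens_eval big_seq1. Qed.

Lemma tens_biadditive : biadditive tens.
Proof.
split=> [n x y|m x y]; rewrite /tens -tens_class_cat;
  apply: tens_classP => P b [h1 h2].
- by rewrite /tens_eval big_cat !big_seq1 h1.
- by rewrite /tens_eval big_cat !big_seq1 h2.
Qed.

End Tensor.

Definition tens_map (M N M' N' : zmodType) (f : M -> M') (g : N -> N') :
    tensor M N -> tensor M' N' :=
  tens_lift (fun m n => tens (f m) (g n)).

(* The degree 2 part of the free Lie ring on M, as a subgroup of M (x) M;
   sums of brackets suffice since -[a, b] = [b, a]. *)
Section Lie2.
Variable M : zmodType.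

Definition bracket (a b : M) : tensor M M := tens a b - tens b a.

Definition lie2_pred : {pred tensor M M} := fun x =>
  `[< exists s : seq (M * M), x = \sum_(u <- s) bracket u.1 u.2 >].

Lemma lie2_zmod_closed : zmod_closed lie2_pred.
Proof.
split=> [|x y].
  by rewrite unfold_in; apply/asboolP; exists [::]; rewrite big_nil.
rewrite !unfold_in => /asboolP[s ->] /asboolP[t ->]; apply/asboolP.
exists (s ++ [seq (u.2, u.1) | u <- t]).
rewrite big_cat big_map -sumrN; congr (_ + _); apply: eq_bigr => u _.
by rewrite /bracket opprB.
Qed.

HB.instance Definition _ :=
  GRing.isZmodClosed.Build (tensor M M) lie2_pred lie2_zmod_closed.

Record lie2 := Lie2 { lie2_val :> tensor M M; _ : lie2_val \in lie2_pred }.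
HB.instance Definition _ := [isSub for lie2_val].
HB.instance Definition _ := [Choice of lie2 by <:].
HB.instance Definition _ := [SubChoice_isSubZmodule of lie2 by <:].

Lemma lie2_bracket_subproof (a b : M) : bracket a b \in lie2_pred.
Proof.
by rewrite unfold_in; apply/asboolP; exists [:: (a, b)]; rewrite big_seq1.
Qed.

Definition lie2_bracket (a b : M) : lie2 := Lie2 (lie2_bracket_subproof a b).

End Lie2.

Section Lie2Map.
Variables (M N : zmodType) (f : {additive M -> N}).

Lemma tens_map_biadditive : biadditive (fun a b : M => tens (f a) (f b)).
Proof.
by split=> [b x y|a x y] /=; rewrite raddfD; [apply: (tens_biadditive _ _).1|
  apply: (tens_biadditive _ _).2].
Qed.

Lemma lie2_map_subproof (x : lie2 M) : tens_map f f x \in @lie2_pred N.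
Proof.
case: x => x /= hx.
pose h := tens_map f f; have hD : {morph h : x y / x + y}.
  exact: tens_liftD tens_map_biadditive.
have h0 : h 0 = 0 by apply: (@addrI _ (h 0)); rewrite -hD !addr0.
have hN y : h (- y) = - h y.
  by apply: (@addrI _ (h y)); rewrite -hD !subrr.
move: hx; rewrite !unfold_in => /asboolP[s ->]; apply/asboolP.
exists [seq (f u.1, f u.2) | u <- s].
rewrite big_map -/h (big_morph h hD h0); apply: eq_bigr => u _.
by rewrite /bracket hD hN /h /tens_map !tens_lift_tens //; exact: tens_map_biadditive.
Qed.

Definition lie2_map (x : lie2 M) : lie2 N := Lie2 (lie2_map_subproof x).

End Lie2Map.

(* The graph of the canonical isomorphism from Gamma_2 G / Gamma_3 G (for G a
   free group) to the degree 2 part of the free Lie ring on the abelianization;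
   elements of Gamma_3 G are in relation with 0. The library's commutator
   [~ x, y] = x^-1 y^-1 x y is congruent to x y x^-1 y^-1 modulo Gamma_3 G. *)
Inductive gr2 (G : groupType) : G -> lie2 (abel G) -> Prop :=
| gr2_1 : gr2 1%g 0
| gr2_comm x y : gr2 [~ x, y]%g (lie2_bracket (ab x) (ab y))
| gr2_M x y a b : gr2 x a -> gr2 y b -> gr2 (x * y)%g (a + b)
| gr2_V x a : gr2 x a -> gr2 x^-1%g (- a).

(* The library's {malg int[K]} is a ring only when K has no nontrivial
   invertible elements, hence the following instance for groups. *)
Definition groupring (G : groupType) : Type := {malg int[G]}.
HB.instance Definition _ (G : groupType) := GRing.Zmodule.on (groupring G).

Section GroupRing.
Variable G : groupType.
Implicit Types a b c : {malg int[G]}.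

Definition gr (x : G) : groupring G := << x >>.

Definition gr_mul a b : {malg int[G]} :=
  \sum_(x <- msupp a) \sum_(y <- msupp b) << a@_x * b@_y *g (x * y)%g >>.

Lemma gr_mulw (d1 d2 : {fset G}) a b :
  (msupp a `<=` d1)%fset -> (msupp b `<=` d2)%fset ->
  gr_mul a b = \sum_(x <- d1) \sum_(y <- d2) << a@_x * b@_y *g (x * y)%g >>.
Proof.
move=> le1 le2; rewrite /gr_mul (big_fset_incl _ le1) /=.
  apply/eq_bigr=> x _; apply/big_fset_incl => // y _ /mcoeff_outdom ->.
  by rewrite mulr0 monalgU0.
move=> x _ /mcoeff_outdom ax.
by rewrite big1 => // y _; rewrite ax mul0r monalgU0.
Qed.

Lemma gr_mulDl : left_distributive gr_mul +%R.
Proof.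
move=> a b c.
rewrite (gr_mulw (msuppD_le a b) (fsubset_refl _)).
rewrite (gr_mulw (fsubsetUl (msupp a) (msupp b)) (fsubset_refl _)).
rewrite (gr_mulw (fsubsetUr (msupp a) (msupp b)) (fsubset_refl _)).
rewrite -big_split /=; apply/eq_bigr=> x _.
rewrite -big_split /=; apply/eq_bigr=> y _.
by rewrite mcoeffD mulrDl monalgUD.
Qed.

Lemma gr_mulDr : right_distributive gr_mul +%R.
Proof.
move=> c a b.
rewrite (gr_mulw (fsubset_refl _) (msuppD_le a b)).
rewrite (gr_mulw (fsubset_refl _) (fsubsetUl (msupp a) (msupp b))).
rewrite (gr_mulw (fsubset_refl _) (fsubsetUr (msupp a) (msupp b))).
rewrite -big_split /=; apply/eq_bigr=> x _.
rewrite -big_split /=; apply/eq_bigr=> y _.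
by rewrite mcoeffD mulrDr monalgUD.
Qed.

Lemma gr_mul0l : left_zero 0 gr_mul.
Proof. by move=> a; rewrite /gr_mul msupp0 big_seq_fset0. Qed.

Lemma gr_mul0r : right_zero 0 gr_mul.
Proof.
by move=> a; rewrite /gr_mul msupp0 big1 // => x _; rewrite big_seq_fset0.
Qed.

Lemma gr_mulUU (m n : int) (x y : G) :
  gr_mul << m *g x >> << n *g y >> = << m * n *g (x * y)%g >>.
Proof. by rewrite (gr_mulw msuppU_le msuppU_le) !big_seq_fset1 !mcoeffUU. Qed.

Lemma malg_ind (P : {malg int[G]} -> Prop) :
  P 0 -> (forall a b, P a -> P b -> P (a + b)) ->
  (forall m x, P << m *g x >>) -> forall a, P a.
Proof. by move=> P0 PD PU a; rewrite [a]monalgE; apply: big_ind. Qed.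

Lemma gr_mulA : associative gr_mul.
Proof.
move=> a b c.
elim/malg_ind: a => [|a a' IH IH'|m x]; first by rewrite !gr_mul0l.
  by rewrite !gr_mulDl IH IH'.
elim/malg_ind: b => [|b b' IH IH'|n y].
- by rewrite !(gr_mul0l, gr_mul0r).
- by rewrite !(gr_mulDl, gr_mulDr) IH IH'.
elim/malg_ind: c => [|c c' IH IH'|p z]; first by rewrite !gr_mul0r.
  by rewrite !gr_mulDr IH IH'.
by rewrite !gr_mulUU mulrA mulgA.
Qed.

Lemma gr_mul1l : left_id << 1%g >> gr_mul.
Proof.
move=> a; elim/malg_ind: a => [|a b IH IH'|m x]; first exact: gr_mul0r.
  by rewrite gr_mulDr IH IH'.
by rewrite gr_mulUU mul1r mul1g.
Qed.

Lemma gr_mul1r : right_id << 1%g >> gr_mul.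
Proof.
move=> a; elim/malg_ind: a => [|a b IH IH'|m x]; first exact: gr_mul0l.
  by rewrite gr_mulDl IH IH'.
by rewrite gr_mulUU mulr1 mulg1.
Qed.

Lemma gr_1neq0 : << 1%g >> != 0 :> {malg int[G]}.
Proof. by rewrite monalgU_eq0. Qed.

HB.instance Definition _ := GRing.Zmodule_isNzRing.Build (groupring G)
  gr_mulA gr_mul1l gr_mul1r gr_mulDl gr_mulDr gr_1neq0.

Lemma grM (x y : G) : gr (x * y)%g = gr x * gr y.
Proof. by rewrite /gr [RHS]gr_mulUU mulr1. Qed.

Lemma gr1 : gr 1%g = 1.
Proof. by []. Qed.

Definition gr_map (K : groupType) (f : G -> K) (a : groupring G) : groupring K :=
  \sum_(x <- msupp a) << a@_x *g f x >>.

End GroupRing.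

Lemma gr_mulC (M : zmodType) :
  commutative (@GRing.mul (groupring (GRing.to_multiplicative M))).
Proof.
move=> a b; elim/malg_ind: a => [|a a' IH IH'|m x].
- by rewrite mulr0 mul0r.
- by rewrite mulrDr mulrDl IH IH'.
elim/malg_ind: b => [|b b' IH IH'|n y].
- by rewrite mulr0 mul0r.
- by rewrite mulrDr mulrDl IH IH'.
by rewrite [LHS]gr_mulUU [RHS]gr_mulUU mulrC; congr << _ *g _ >>; exact: addrC.
Qed.

HB.instance Definition _ (M : zmodType) :=
  GRing.PzRing_hasCommutativeMul.Build
    (groupring (GRing.to_multiplicative M)) (@gr_mulC M).

Definition gr_bar (G : groupType) : groupring G -> groupring G :=
  gr_map (fun x : G => x^-1%g).

Definition gr_ab (G : groupType) :
    groupring G -> groupring (GRing.to_multiplicative (abel G)) :=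
  @gr_map G (GRing.to_multiplicative (abel G)) (@ab G).

Section Fox.
Variables (G : groupType) (I : eqType) (b : I -> G).

Definition is_fox_derivative (i : I) (D : groupring G -> groupring G) : Prop :=
  [/\ {morph D : x y / x + y},
      forall j, D (gr (b j)) = (i == j)%:R &
      forall u v : G, D (gr (u * v)%g) = D (gr u) + gr u * D (gr v)].

(* For b a basis of the free group G there is exactly one such D. *)
Definition fox (i : I) : groupring G -> groupring G :=
  xget (fun=> 0) [set D | is_fox_derivative i D].

End Fox.

Section Maps.
Context {X Y : topologicalType}.

Definition homeomorphism (f : X -> Y) : Prop :=
  continuous f /\
  exists f' : Y -> X, [/\ continuous f', cancel f f' & cancel f' f].

Definition embedding (f : X -> Y) : Prop :=
  [/\ continuous f, injective f &
      forall U : set X, open U -> exists2 W : set Y, open W & f @^-1` W = U].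

Definition open_embedding (f : X -> Y) : Prop :=
  [/\ continuous f, injective f & forall U : set X, open U -> open (f @` U)].

Record pointed_map (p : X) (q : Y) := PointedMap {
  pointed_map_fun :> X -> Y;
  pointed_map_continuous : continuous pointed_map_fun;
  pointed_map_base : pointed_map_fun p = q
}.

End Maps.

Section Paste.
Context {R : realType} {X T : topologicalType}.

Lemma paste_continuous (h : X -> R) (f g : X -> T) :
  continuous h -> continuous f -> continuous g ->
  (forall x, h x = 0 -> f x = g x) ->
  continuous (fun x => if h x <= 0 then f x else g x).
Proof.
move=> ch cf cg fg x.
have [hx|hx|hx] := ltgtP (h x) 0.
- move=> U /=; rewrite (ltW hx) => Ux.
  have h1 : \forall y \near x, U (f y) by exact: (cf x).
  have h2 : \forall y \near x, h y < 0.
    have nh : nbhs (h x) [set z | z < 0].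
      by apply: open_nbhs_nbhs; split=> //; exact: open_lt.
    exact: (ch x _ nh).
  rewrite nbhs_filterE /=.
  by apply: filterS2 h1 h2 => y /= ? /ltW ->.
- move=> U /=; rewrite leNgt hx /= => Ux.
  have h1 : \forall y \near x, U (g y) by exact: (cg x).
  have h2 : \forall y \near x, 0 < h y.
    have nh : nbhs (h x) [set z | 0 < z].
      by apply: open_nbhs_nbhs; split=> //; exact: open_gt.
    exact: (ch x _ nh).
  rewrite nbhs_filterE /=.
  by apply: filterS2 h1 h2 => y /= ? hy; rewrite leNgt hy.
- move=> U /=; rewrite hx lexx => Ux.
  have h1 : \forall y \near x, U (f y) by exact: (cf x).
  have h2 : \forall y \near x, U (g y) by apply: (cg x); rewrite -fg.
  rewrite nbhs_filterE /=.
  by apply: filterS2 h1 h2 => y /=; case: ifP.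
Qed.

End Paste.


Section Continuity.
Context {R : realType}.

Lemma pair_cont (X A B : topologicalType) (u : X -> A) (v : X -> B) :
  continuous u -> continuous v -> continuous (fun x => (u x, v x)).
Proof. by move=> cu cv x; apply: cvg_pair => /=; [exact: cu|exact: cv]. Qed.

Lemma comp_cont (X Y Z : topologicalType) (g : Y -> Z) (f : X -> Y) :
  continuous g -> continuous f -> continuous (fun x => g (f x)).
Proof. by move=> cg cf x; apply: continuous_comp; [exact: cf|exact: cg]. Qed.

Lemma fst_cont (A B : topologicalType) : continuous (fun x : A * B => x.1).
Proof. by move=> x; exact: cvg_fst. Qed.

Lemma snd_cont (A B : topologicalType) : continuous (fun x : A * B => x.2).
Proof. by move=> x; exact: cvg_snd. Qed.

Lemma id_cont (X : topologicalType) : continuous (fun x : X => x).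
Proof. by move=> x. Qed.

Lemma cst_cont (X Y : topologicalType) (a : Y) : continuous (fun _ : X => a).
Proof. by move=> x; exact: cvg_cst. Qed.

Lemma add_cont (X : topologicalType) (f g : X -> R) :
  continuous f -> continuous g -> continuous (fun x => f x + g x).
Proof. by move=> cf cg x; apply: continuousD; [exact: cf|exact: cg]. Qed.

Lemma opp_cont (X : topologicalType) (f : X -> R) :
  continuous f -> continuous (fun x => - f x).
Proof. by move=> cf x; apply: continuousN; exact: cf. Qed.

Lemma mul_cont (X : topologicalType) (f g : X -> R) :
  continuous f -> continuous g -> continuous (fun x => f x * g x).
Proof. by move=> cf cg x; apply: continuousM; [exact: cf|exact: cg]. Qed.

End Continuity.

Ltac cont := repeat first
  [ exact: fst_cont | exact: snd_cont | exact: id_cont | exact: cst_cont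
  | apply: add_cont | apply: opp_cont | apply: mul_cont | apply: pair_cont
  | assumption ].

Section Loops.
Context {R : realType} {T : topologicalType}.
Variable p : T.

(* Loops [0, 1] -> T, extended to R by the constant p outside [0, 1]. *)
Record loop := Loop {
  loop_fun :> R -> T;
  loop_continuous : continuous loop_fun;
  loop_out : forall t, t <= 0 \/ 1 <= t -> loop_fun t = p
}.

HB.instance Definition _ := gen_eqMixin loop.
HB.instance Definition _ := gen_choiceMixin loop.

(* Homotopies relative to the end points, likewise extended to R x R. *)
Definition homotopic (c d : loop) : Prop :=
  exists K : R * R -> T,
    [/\ continuous K,
        forall t, K (0, t) = c t,
        forall t, K (1, t) = d t &
        forall s t, t <= 0 \/ 1 <= t -> K (s, t) = p].

Lemma homotopic_ext (c d : loop) : (forall t, c t = d t) -> homotopic c d.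
Proof.
move=> cd; exists (fun x => c x.2); split=> //=; last by move=> _ t; exact: loop_out.
by apply: comp_cont; [exact: loop_continuous|exact: snd_cont].
Qed.

Lemma homotopic_refl c : homotopic c c.
Proof. exact: homotopic_ext. Qed.

Lemma homotopic_sym c d : homotopic c d -> homotopic d c.
Proof.
move=> [K [cK K0 K1 Kp]]; exists (fun x => K (1 - x.1, x.2)); split=> /=.
- by apply: comp_cont => //; cont.
- by move=> t; rewrite subr0.
- by move=> t; rewrite subrr.
- by move=> s t /Kp.
Qed.

Lemma homotopic_trans c d e : homotopic c d -> homotopic d e -> homotopic c e.
Proof.
move=> [K [cK K0 K1 Kp]] [L [cL L0 L1 Lp]].
exists (fun x => if 2 * x.1 - 1 <= 0 then K (2 * x.1, x.2)
                 else L (2 * x.1 - 1, x.2)); split=> /=.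
- apply: (@paste_continuous _ _ _ (fun x : R * R => 2 * x.1 - 1)).
  + by cont.
  + by apply: comp_cont => //; cont.
  + by apply: comp_cont => //; cont.
  + move=> x hx; rewrite hx L0 (_ : 2 * x.1 = 1) ?K1 //; lra.
- by move=> t; rewrite mulr0 sub0r lerN10.
- move=> t; rewrite mulr1 ifF; first by rewrite (_ : 2 - 1 = 1) ?L1 //; lra.
  by apply/negbTE; rewrite -ltNge; lra.
- by move=> s t h; case: ifP => _; [exact: Kp|exact: Lp].
Qed.

Lemma loop_concat_continuous (c d : loop) :
  continuous (fun t : R => if 2 * t - 1 <= 0 then c (2 * t) else d (2 * t - 1)).
Proof.
apply: (@paste_continuous _ _ _ (fun t : R => 2 * t - 1)).
- by cont.
- by apply: comp_cont; [exact: loop_continuous|cont].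
- by apply: comp_cont; [exact: loop_continuous|cont].
- by move=> t ht; rewrite !loop_out //; [left; lra|right; lra].
Qed.

Lemma loop_concat_out (c d : loop) t : t <= 0 \/ 1 <= t ->
  (if 2 * t - 1 <= 0 then c (2 * t) else d (2 * t - 1)) = p.
Proof.
move=> ht; case: ifP => h; rewrite loop_out //.
- by case: ht => ht; [left; lra|right; lra].
- by case: ht => ht; [left; lra|right; lra].
Qed.

Definition loop_concat (c d : loop) : loop :=
  Loop (@loop_concat_continuous c d) (@loop_concat_out c d).

Lemma loop_rev_continuous (c : loop) : continuous (fun t : R => c (1 - t)).
Proof. by apply: comp_cont; [exact: loop_continuous|cont]. Qed.

Lemma loop_rev_out (c : loop) t : t <= 0 \/ 1 <= t -> c (1 - t) = p.
Proof. by move=> ht; apply: loop_out; case: ht => ht; [right; lra|left; lra]. Qed.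

Definition loop_rev (c : loop) : loop :=
  Loop (@loop_rev_continuous c) (@loop_rev_out c).

Definition loop_cst : loop :=
  Loop (@cst_cont R T p) (fun (t : R) (_ : t <= 0 \/ 1 <= t) => erefl p).

Lemma homotopic_concat c c' d d' : homotopic c c' -> homotopic d d' ->
  homotopic (loop_concat c d) (loop_concat c' d').
Proof.
move=> [K [cK K0 K1 Kp]] [L [cL L0 L1 Lp]].
exists (fun x => if 2 * x.2 - 1 <= 0 then K (x.1, 2 * x.2)
                 else L (x.1, 2 * x.2 - 1)); split=> /=.
- apply: (@paste_continuous _ _ _ (fun x : R * R => 2 * x.2 - 1)).
  + by cont.
  + by apply: comp_cont => //; cont.
  + by apply: comp_cont => //; cont.
  + by move=> x hx; rewrite Kp ?Lp //; [left; lra|right; lra].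
- by move=> t; rewrite K0 L0.
- by move=> t; rewrite K1 L1.
- move=> s t ht; case: ifP => h; [rewrite Kp|rewrite Lp] => //.
  + by case: ht => ht; [left; lra|right; lra].
  + by case: ht => ht; [left; lra|right; lra].
Qed.

Lemma homotopic_rev c d : homotopic c d -> homotopic (loop_rev c) (loop_rev d).
Proof.
move=> [K [cK K0 K1 Kp]]; exists (fun x => K (x.1, 1 - x.2)); split=> /=.
- by apply: comp_cont => //; cont.
- by move=> t; rewrite K0.
- by move=> t; rewrite K1.
- by move=> s t ht; apply: Kp; case: ht => ht; [right; lra|left; lra].
Qed.

Lemma homotopic_reparam (c d e : loop) (u v : R -> R) :
  continuous u -> continuous v ->
  (forall t, d t = c (u t)) -> (forall t, e t = c (v t)) ->
  (forall t, t <= 0 \/ 1 <= t ->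
     (u t <= 0 /\ v t <= 0) \/ (1 <= u t /\ 1 <= v t)) ->
  homotopic d e.
Proof.
move=> cu cv du ev uv.
pose m (s : R) : R := if s <= 0 then 0 else (if s - 1 <= 0 then s else 1).
have cm : continuous m.
  apply: (@paste_continuous _ _ _ (fun s : R => s)); [by cont|by cont| |].
  - apply: (@paste_continuous _ _ _ (fun s : R => s - 1)); [by cont..|].
    by move=> s; lra.
  - by move=> s ->; rewrite sub0r lerN10.
have m01 s : 0 <= m s <= 1.
  by rewrite /m; case: ifP => h1; [|case: ifP => h2]; lra.
exists (fun x => c ((1 - m x.1) * u x.2 + m x.1 * v x.2)); split=> /=.
- apply: comp_cont; first exact: loop_continuous.
  have cm1 : continuous (fun x : R * R => m x.1) by apply: comp_cont => //; cont.
  have cu2 : continuous (fun x : R * R => u x.2) by apply: comp_cont => //; cont.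
  have cv2 : continuous (fun x : R * R => v x.2) by apply: comp_cont => //; cont.
  by cont.
- by move=> t; rewrite /m lexx subr0 mul1r mul0r addr0 du.
- by move=> t; rewrite /m ler10 subrr lexx subrr mul0r add0r mul1r ev.
- move=> s t /uv h; apply: loop_out; have /andP[ms0 ms1] := m01 s.
  by case: h => -[hu hv]; [left; nra|right; nra].
Qed.

Lemma homotopic_assoc c d e :
  homotopic (loop_concat c (loop_concat d e)) (loop_concat (loop_concat c d) e).
Proof.
pose v (t : R) := if 4 * t - 1 <= 0 then 2 * t
                  else (if 2 * t - 1 <= 0 then t + 1 / 4 else (t + 1) / 2).
apply: (@homotopic_reparam (loop_concat c (loop_concat d e)) _ _ (fun t => t) v).
- by cont.
- apply: (@paste_continuous _ _ _ (fun t : R => 4 * t - 1)); [by cont..| |].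
  + apply: (@paste_continuous _ _ _ (fun t : R => 2 * t - 1)); [by cont..|].
    by move=> t ht; lra.
  + by move=> t ht; rewrite ifT; lra.
- by [].
- move=> t; rewrite /v /=.
  have [h1|h1] := lerP (4 * t - 1) 0.
    rewrite !ifT; [by congr (c _); lra|lra..].
  have [h2|h2] := lerP (2 * t - 1) 0.
    rewrite ifF; last by apply/negbTE; rewrite -ltNge; lra.
    rewrite ifF; last by apply/negbTE; rewrite -ltNge; lra.
    by rewrite ifT; [congr (d _); lra|lra].
  rewrite ifF; last by apply/negbTE; rewrite -ltNge; lra.
  rewrite ifF; last by apply/negbTE; rewrite -ltNge; lra.
  by congr (e _); lra.
- move=> t ht; rewrite /v.
  have [h1|h1] := lerP (4 * t - 1) 0; first by left; lra.
  have [h2|h2] := lerP (2 * t - 1) 0; first by exfalso; lra.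
  by right; lra.
Qed.

Lemma homotopic_cstl c : homotopic (loop_concat loop_cst c) c.
Proof.
apply: (@homotopic_reparam c _ _ (fun t => 2 * t - 1) (fun t => t)); [by cont..| | |].
- by move=> t /=; case: ifP => // h; rewrite loop_out //; left.
- by [].
- by move=> t [ht|ht]; [left; lra|right; lra].
Qed.

Lemma homotopic_cstr c : homotopic (loop_concat c loop_cst) c.
Proof.
apply: (@homotopic_reparam c _ _ (fun t => 2 * t) (fun t => t)); [by cont..| | |].
- move=> t /=; case: lerP => // h; rewrite loop_out //; right; lra.
- by [].
- by move=> t [ht|ht]; [left; lra|right; lra].
Qed.

Lemma homotopic_revl c : homotopic (loop_concat (loop_rev c) c) loop_cst.
Proof.
apply: (@homotopic_reparam c _ _
  (fun t => if 2 * t - 1 <= 0 then 1 - 2 * t else 2 * t - 1) (fun=> 1)).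
- apply: (@paste_continuous _ _ _ (fun t : R => 2 * t - 1)); [by cont..|].
  by move=> t ht; lra.
- by cont.
- by move=> t /=; case: ifP.
- by move=> t /=; rewrite loop_out //; right.
- by move=> t [ht|ht] /=; have [h|h] := lerP (2 * t - 1) 0; right; split; lra.
Qed.

Lemma homotopic_revr c : homotopic (loop_concat c (loop_rev c)) loop_cst.
Proof.
apply: (@homotopic_reparam c _ _
  (fun t => if 2 * t - 1 <= 0 then 2 * t else 2 - 2 * t) (fun=> 0)).
- apply: (@paste_continuous _ _ _ (fun t : R => 2 * t - 1)); [by cont..|].
  by move=> t ht; lra.
- by cont.
- by move=> t /=; case: ifP => // _; congr (c _); lra.
- by move=> t /=; rewrite loop_out //; left.
- by move=> t [ht|ht] /=; have [h|h] := lerP (2 * t - 1) 0; left; split; lra.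
Qed.

Definition homotopic_rel : rel loop := fun c d => `[< homotopic c d >].

Lemma homotopic_rel_refl : reflexive homotopic_rel.
Proof. by move=> c; apply/asboolP; exact: homotopic_refl. Qed.

Lemma homotopic_rel_sym : symmetric homotopic_rel.
Proof. by move=> c d; apply/asboolP/asboolP => /homotopic_sym. Qed.

Lemma homotopic_rel_trans : transitive homotopic_rel.
Proof.
move=> d c e /asboolP h1 /asboolP h2; apply/asboolP.
exact: homotopic_trans h1 h2.
Qed.

Canonical homotopic_equiv :=
  EquivRel homotopic_rel homotopic_rel_refl homotopic_rel_sym homotopic_rel_trans.

Definition pi1 := {eq_quot homotopic_rel}.
HB.instance Definition _ := Choice.on pi1.

Definition loop_class (c : loop) : pi1 := \pi_pi1 c.

Lemma loop_classP c d : loop_class c = loop_class d <-> homotopic c d.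
Proof.
rewrite /loop_class; split=> [/eqP|h]; last apply/eqP.
  by rewrite eqmodE => /asboolP.
by rewrite eqmodE; apply/asboolP.
Qed.

Lemma loop_class_surj (x : pi1) : exists c, x = loop_class c.
Proof. by exists (repr x); rewrite /loop_class reprK. Qed.

Lemma loop_class_repr c : homotopic (repr (loop_class c)) c.
Proof. by apply/loop_classP; rewrite [LHS]reprK. Qed.

Definition pi1_mul (x y : pi1) : pi1 := loop_class (loop_concat (repr x) (repr y)).
Definition pi1_inv (x : pi1) : pi1 := loop_class (loop_rev (repr x)).

Lemma pi1_mulE c d :
  pi1_mul (loop_class c) (loop_class d) = loop_class (loop_concat c d).
Proof. by apply/loop_classP/homotopic_concat; exact: loop_class_repr. Qed.

Lemma pi1_invE c : pi1_inv (loop_class c) = loop_class (loop_rev c).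
Proof. by apply/loop_classP/homotopic_rev; exact: loop_class_repr. Qed.

Lemma pi1_mulA : associative pi1_mul.
Proof.
move=> x y z; have [c ->] := loop_class_surj x.
have [d ->] := loop_class_surj y; have [e ->] := loop_class_surj z.
by rewrite !pi1_mulE; apply/loop_classP; exact: homotopic_assoc.
Qed.

Lemma pi1_mul1 : left_id (loop_class loop_cst) pi1_mul.
Proof.
move=> x; have [c ->] := loop_class_surj x; rewrite pi1_mulE.
by apply/loop_classP; exact: homotopic_cstl.
Qed.

Lemma pi1_1mul : right_id (loop_class loop_cst) pi1_mul.
Proof.
move=> x; have [c ->] := loop_class_surj x; rewrite pi1_mulE.
by apply/loop_classP; exact: homotopic_cstr.
Qed.

Lemma pi1_mulV : left_inverse (loop_class loop_cst) pi1_inv pi1_mul.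
Proof.
move=> x; have [c ->] := loop_class_surj x; rewrite pi1_invE pi1_mulE.
by apply/loop_classP; exact: homotopic_revl.
Qed.

Lemma pi1_Vmul : right_inverse (loop_class loop_cst) pi1_inv pi1_mul.
Proof.
move=> x; have [c ->] := loop_class_surj x; rewrite pi1_invE pi1_mulE.
by apply/loop_classP; exact: homotopic_revr.
Qed.

HB.instance Definition _ :=
  isGroup.Build pi1 pi1_mulA pi1_mul1 pi1_1mul pi1_mulV pi1_Vmul.

End Loops.

Arguments loop : clear implicits.
Arguments loop R {T} p.
Arguments pi1 : clear implicits.
Arguments pi1 R {T} p.

Section Pi1Map.
Context {R : realType} {X Y : topologicalType} {p : X} {q : Y}.
Variable f : pointed_map p q.

Lemma loop_map_continuous (c : loop R p) : continuous (fun t : R => f (c t)).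
Proof.
by apply: comp_cont; [exact: pointed_map_continuous|exact: loop_continuous].
Qed.

Lemma loop_map_out (c : loop R p) t : t <= 0 \/ 1 <= t -> f (c t) = q.
Proof. by move=> /loop_out ->; exact: pointed_map_base. Qed.

Definition loop_map (c : loop R p) : loop R q :=
  Loop (@loop_map_continuous c) (@loop_map_out c).

Definition pi1_map (x : pi1 R p) : pi1 R q := loop_class (loop_map (repr x)).

Lemma loop_map_homotopic c d : homotopic c d -> homotopic (loop_map c) (loop_map d).
Proof.
move=> [K [cK K0 K1 Kp]]; exists (fun x => f (K x)); split=> /=.
- by apply: comp_cont => //; exact: pointed_map_continuous.
- by move=> t; rewrite K0.
- by move=> t; rewrite K1.
- by move=> s t /Kp ->; exact: pointed_map_base.
Qed.

Lemma pi1_mapE c : pi1_map (loop_class c) = loop_class (loop_map c).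
Proof. by apply/loop_classP/loop_map_homotopic; exact: loop_class_repr. Qed.

Lemma pi1_map_mul : {morph pi1_map : x y / (x * y)%g}.
Proof.
move=> x y; have [c ->] := loop_class_surj x; have [d ->] := loop_class_surj y.
rewrite [(_ * _)%g in LHS]pi1_mulE !pi1_mapE [RHS]pi1_mulE.
apply/loop_classP/homotopic_ext => t /=; by case: ifP.
Qed.

HB.instance Definition _ :=
  mathcomp.boot.monoid.isMultiplicative.Build (pi1 R p) (pi1 R q) pi1_map pi1_map_mul.

End Pi1Map.

Section Models.
Variable R : realType.

(* A rectangle with g disjoint open square holes. *)
Definition holed_rectangle (g : nat) : set (R * R) :=
  [set u | [/\ 0 <= u.1 <= (2 * g + 1)%:R, 0 <= u.2 <= 3 &
     forall k, (k < g)%N ->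
       ~ ((2 * k + 1)%:R < u.1 < (2 * k + 2)%:R /\ 1 < u.2 < 2)]].

Definition std_handlebody (g : nat) : set (R * R * R) :=
  [set u | holed_rectangle g u.1 /\ 0 <= u.2 <= 1].

(* An open disk in the top face of the boundary. *)
Definition std_disk : set (R * R * R) :=
  [set u | [/\ 1 / 4 < u.1.1 < 3 / 4, 1 / 4 < u.1.2 < 3 / 4 & u.2 = 1]].

Definition std_surface (g : nat) : set (R * R * R) :=
  (std_handlebody g `\` (std_handlebody g)^°) `\` std_disk.

(* i : S -> V is the inclusion of a compact surface of genus g with one
   boundary component into a handlebody of genus g, as the boundary of the
   handlebody minus an open disk: by the classification of surfaces and of
   handlebodies, (V, i(S)) is homeomorphic to the model pair in R^3. *)
Definition handlebody_pair (g : nat) (S V : topologicalType) (i : S -> V) : Prop :=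
  exists e : V -> R * R * R,
    [/\ embedding e, range e = std_handlebody g,
        embedding (e \o i) & range (e \o i) = std_surface g].

Context {S : topologicalType}.
Implicit Types c d : R -> S.

(* The boundary of a surface: the points without a neighbourhood homeomorphic
   to the plane. *)
Definition surface_boundary : set S :=
  [set s | ~ exists2 e : R * R -> S, open_embedding e & range e s].

(* On a connected orientable surface the open embeddings of the plane form
   exactly two isotopy classes, which are the two orientations. An orientation
   is given by an element of its class. *)
Definition isotopic_charts (e e' : R * R -> S) : Prop :=
  exists E : R * (R * R) -> S,
    [/\ continuous E, forall t, open_embedding (fun u => E (t, u)),
        forall u, E (0, u) = e u & forall u, E (1, u) = e' u].

(* The curves c and d meet transversally at c s = d t, with sign (-1) ^+ b: in
   a positive chart, c is the first axis and d is the second axis, traversed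
   backwards if b holds. *)
Definition crossing (o : R * R -> S) c d (s t : R) (b : bool) : Prop :=
  exists (e : R * R -> S) (eps : R),
    [/\ isotopic_charts o e, 0 < eps &
        forall u, `|u| < eps -> c (s + u) = e (u, 0) /\ d (t + u) = e (0, (-1) ^+ b * u)].

Variable p : S.

(* The 1-periodic curve c represents the conjugacy class of x. *)
Definition freely_represents c (x : pi1 R p) : Prop :=
  [/\ continuous c, forall t, c (t + 1) = c t &
      exists (l : loop R p) (K : R * R -> S),
        [/\ x = loop_class l, continuous K,
            forall t, 0 <= t <= 1 -> K (0, t) = l t,
            forall t, 0 <= t <= 1 -> K (1, t) = c t &
            forall s, K (s, 0) = K (s, 1)]].

(* The first homology group is the abelianized fundamental group. *)
Definition H1 := abel (pi1 R p).
HB.instance Definition _ := GRing.Zmodule.on H1.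

(* omega is the (homological) intersection form of S oriented by o: it counts
   with signs the intersection points of any two transverse closed curves. *)
Definition intersection_form (o : R * R -> S) (omega : H1 -> H1 -> int) : Prop :=
  biadditive omega /\
  forall c d (x y : pi1 R p) (X : seq (R * R)) (b : R * R -> bool),
    freely_represents c x -> freely_represents d y ->
    uniq X ->
    (forall st, st \in X <->
       [/\ 0 <= st.1 < 1, 0 <= st.2 < 1 & c st.1 = d st.2]) ->
    (forall st, st \in X -> crossing o c d st.1 st.2 (b st)) ->
    omega (ab x) (ab y) = \sum_(st <- X) (-1) ^+ b st.

End Models.

Section SymplecticBasis.
Variables (G : groupType) (omega : abel G -> abel G -> int).
Variables (g : nat) (alpha beta : 'I_g -> G).

Definition join_families (k : 'I_g + 'I_g) : G :=
  match k with inl a => alpha a | inr b => beta b end.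

Definition symplectic_family : Prop :=
  forall a b : 'I_g,
    [/\ omega (ab (alpha a)) (ab (alpha b)) = 0,
        omega (ab (beta a)) (ab (beta b)) = 0,
        omega (ab (alpha a)) (ab (beta b)) = (a == b)%:R &
        omega (ab (beta a)) (ab (alpha b)) = - (a == b)%:R].

End SymplecticBasis.

Section MappingClasses.
Variable R : realType.
Context {S V : topologicalType} {p : S} {q : V}.

(* Mapping classes are given by representatives f. Isotopic representatives have
   the same action on pi1 R p, hence the same values of all that follows. *)
Definition mapping_class (f : S -> S) : Prop :=
  homeomorphism f /\ forall s, surface_boundary R s -> f s = s.

Definition isotopic (f f' : S -> S) : Prop :=
  exists K : R * S -> S,
    [/\ continuous K, forall t, mapping_class (fun s => K (t, s)),
        forall s, K (0, s) = f s & forall s, K (1, s) = f' s].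

Definition handlebody_group (i : S -> V) (f : S -> S) : Prop :=
  mapping_class f /\
  exists (f' : S -> S) (F : V -> V),
    [/\ isotopic f f', homeomorphism F & forall s, F (i s) = i (f' s)].

Definition johnson_filtration (k : nat) (f : pointed_map p p) : Prop :=
  forall x : pi1 R p, lower_central (pi1 R p) k.+1 (pi1_map f x * x^-1)%g.

(* The first Johnson homomorphism, through the isomorphisms
   H (x) L_2(H) ~ H^* (x) L_2(H) ~ Hom(H, L_2(H)), the first of which is given by
   x |-> omega (x, -). *)
Definition johnson1 (omega : H1 R p -> H1 R p -> int) (f : pointed_map p p) :
    tensor (H1 R p) (lie2 (H1 R p)) :=
  xget 0 [set T | forall x : pi1 R p,
    gr2 (pi1_map f x * x^-1)%g
      (tens_lift (fun (h : H1 R p) (l : lie2 (H1 R p)) => l *~ omega h (ab x)) T)].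

Variable i : pointed_map p q.

Definition H1_map : {additive H1 R p -> H1 R q} := abel_map (pi1_map (R := R) i).

Definition lagrangian := kernel H1_map.

(* The pairing A (x) H' -> Z induced by omega: the second argument is lifted
   to H. *)
Definition omega' (omega : H1 R p -> H1 R p -> int) (a : lagrangian) (h' : H1 R q) : int :=
  omega (val a) (xget 0 [set h | H1_map h = h']).

Definition contraction (omega : H1 R p -> H1 R p -> int) :
    tensor lagrangian (lie2 (H1 R q)) -> H1 R q :=
  tens_lift (fun (a : lagrangian) (l : lie2 (H1 R q)) =>
    tens_lift (fun h1 h2 => h2 *~ omega' omega a h1) (val l)).

(* The projection of T to H (x) L_2(H') is lifted to A (x) L_2(H') and
   contracted. The lift is unique; it exists if and only if T is in the kernel of
   H (x) L_2(H) -> H' (x) L_2(H'), which contains the usual domain of the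
   Lagrangian trace, the kernel G_1 of D_1(H) -> D_1(H'). *)
Definition lagrangian_trace (omega : H1 R p -> H1 R p -> int)
    (T : tensor (H1 R p) (lie2 (H1 R p))) : H1 R q :=
  contraction omega
    (xget 0 [set t | tens_map val id t = tens_map id (lie2_map H1_map) T]).

(* f acts on the fundamental group of V by i_* x |-> i_* (f_* x). *)
Definition magnus (g : nat) (beta : 'I_g -> pi1 R p) (f : pointed_map p p) :
    'M[groupring (pi1 R q)]_g :=
  \matrix_(a, b) gr_bar
    (fox (fun k => pi1_map i (beta k)) a (gr (pi1_map i (pi1_map f (beta b))))).

Definition magnus_ab (g : nat) (beta : 'I_g -> pi1 R p) (f : pointed_map p p) :
    'M[groupring (GRing.to_multiplicative (H1 R q))]_g :=
  map_mx (@gr_ab (pi1 R q)) (magnus beta f).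

End MappingClasses.

(* Main.v *)
(* The Magnus matrix of phi is invertible over Z[H'] by the chain rule for Fox
   derivatives, and it reduces to the identity under the augmentation because phi
   acts trivially on H'. Since H' is free abelian, the units of augmentation 1 of
   Z[H'] are the elements of H', so that the determinant is some h in H'. This h is
   recovered from h - 1 modulo the square of the augmentation ideal I, where
   I / I^2 ~ H'; there the determinant becomes the trace of (matrix - 1), and the
   abelianized Fox derivatives of phi(beta_j') beta_j'^-1, a product of commutators,
   read off its class in L_2(H'). The result is the sum over j of the contractions of
   that class with beta_j'^*, which is also the Lagrangian trace of
   sum_j alpha_j (x) tau_1(phi)(beta_j) - sum_j beta_j (x) tau_1(phi)(alpha_j), as the
   second sum vanishes in H (x) L_2(H'). *)
Require Import Defs.
From HB Require Import structures.
From mathcomp Require Import monalg.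
From mathcomp Require Import all_boot all_order all_algebra perm finmap zify.
From mathcomp Require Import generic_quotient.
From mathcomp Require Import boolp classical_sets reals topology normedtype.

Set Implicit Arguments.
Unset Strict Implicit.
Unset Printing Implicit Defensive.

Import Order.TTheory GRing.Theory Num.Theory numFieldNormedType.Exports.
Local Open Scope classical_set_scope.
Local Open Scope ring_scope.

(** * Free bases *)

Section FreeBasisGenerates.
Local Open Scope group_scope.
Variables (G : groupType) (X : set G).

Definition generated_pred : {pred G} := fun x => `[< generated X x >].

Lemma generated_group_closed : group_closed generated_pred.
Proof.
split=> [|x y]; rewrite !unfold_in; first exact/asboolP/generated1.
move=> /asboolP hx /asboolP hy; apply/asboolP.
by apply: generatedM => //; exact: generatedV.
Qed.

(** As a group in its own right, the generated subgroup can be a target in the universal property of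
    [free_basis]. *)
Record generated_sub := GeneratedSub {
  generated_val :> G; _ : generated_val \in generated_pred }.
HB.instance Definition _ := [isSub for generated_val].
HB.instance Definition _ := [Choice of generated_sub by <:].
HB.instance Definition _ := SubChoice_isSubGroup.Build G generated_pred
  generated_sub generated_group_closed.
End FreeBasisGenerates.

(** The universal property gives a map to the generated subgroup; followed by the inclusion it fixes
    the basis, so by uniqueness it is the identity. *)
Lemma free_basis_generated (G : groupType) (I : Type) (b : I -> G) :
  free_basis b -> forall x, generated (range b) x.
Proof.
move=> fb x.
have bP k : b k \in generated_pred (range b).
  by apply/asboolP/generated_in; exists k.
have [[h hb] _] := fb (generated_sub (range b)) (fun k => GeneratedSub (bP k)).
have [_ /(_ (\val \o h) idfun) /= E] := fb G b.
rewrite -[x]/(idfun x) -E => [|k]; last by rewrite hb.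
by apply/asboolP; exact: (valP (h x)).
Qed.

Lemma free_basis_ind (G : groupType) (I : Type) (b : I -> G) :
  free_basis b -> forall P : G -> Prop, P 1%g -> (forall k, P (b k)) ->
  (forall x y, P x -> P y -> P (x * y)%g) -> (forall x, P x -> P x^-1%g) ->
  forall x, P x.
Proof.
move=> fb P P1 Pb PM PV x; have := free_basis_generated fb x.
by elim=> // [_ [k _ <-]|y z _ Py _ Pz|y _ Py]; [exact: Pb|exact: PM|exact: PV].
Qed.

(** * Group rings and Fox derivatives *)

Section GrLift.
Variable G : groupType.

Lemma monomialE (m : int) (x : G) : mkmalgU x m = gr x *~ m :> groupring G.
Proof.
rewrite -{1}[m]intz.
exact: (raddfMz (mkmalgU x : {additive int -> malg G int}) m 1).
Qed.

Lemma gr_ind (P : groupring G -> Prop) :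
  (forall a b, P a -> P b -> P (a - b)) -> (forall x, P (gr x)) -> forall a, P a.
Proof.
move=> PB Pg; have P0 : P 0 by rewrite -(subrr (gr 1%g)); exact: PB.
have PN a : P a -> P (- a) by rewrite -[- a]add0r; exact: PB.
have PD a b : P a -> P b -> P (a + b) by rewrite -{2}[b]opprK => ? /PN; exact: PB.
have PM a n : P a -> P (a *+ n) by move=> Pa; elim: n => // n; rewrite mulrS; exact: PD.
apply: malg_ind => // m x.
rewrite monomialE; case: m => n; rewrite -?pmulrn ?NegzE ?mulrNz -?pmulrn.
  exact: PM.
exact/PN/PM.
Qed.

Lemma gr_additive_eq (P : zmodType) (f h : groupring G -> P) :
  {morph f : a b / a - b} -> {morph h : a b / a - b} ->
  (forall x, f (gr x) = h (gr x)) -> f =1 h.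
Proof. by move=> fB hB E; apply: gr_ind => // a b Ea Eb; rewrite fB hB Ea Eb. Qed.

Variables (P : zmodType) (f : G -> P).

Definition gr_lift (a : groupring G) : P :=
  \sum_(x <- msupp a) f x *~ mcoeff x a.

(** Freedom in the index set lets two elements be compared over the union of their supports. *)
Lemma gr_liftw (d : {fset G}) (a : groupring G) : (msupp a `<=` d)%fset ->
  gr_lift a = \sum_(x <- d) f x *~ mcoeff x a.
Proof.
by move=> le; apply: big_fset_incl => // x _ /mcoeff_outdom ->.
Qed.

Lemma gr_liftB : {morph gr_lift : a b / a - b}.
Proof.
move=> a b; pose d := (msupp a `|` msupp b)%fset.
rewrite (@gr_liftw d) ?msuppB_le // (@gr_liftw d a) ?fsubsetUl //.
rewrite (@gr_liftw d b) ?fsubsetUr // -sumrB; apply: eq_bigr => x _.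
by rewrite mcoeffB mulrzBr.
Qed.

HB.instance Definition _ :=
  GRing.isZmodMorphism.Build (groupring G) P gr_lift gr_liftB.

Lemma gr_lift_gr x : gr_lift (gr x) = f x.
Proof.
rewrite (@gr_liftw [fset x]%fset) ?msuppU_le //.
by rewrite big_seq_fset1 mcoeffUU.
Qed.
End GrLift.

Lemma gr_lift_monoid (G : groupType) (S : pzRingType) (f : G -> S) :
  {morph f : x y / (x * y)%g >-> x * y} -> {morph gr_lift f : a b / a * b}.
Proof.
move=> fM a b; elim/gr_ind: a => [a a' E E'|x].
  by rewrite mulrBl !gr_liftB E E' mulrBl.
elim/gr_ind: b => [b b' E E'|y]; first by rewrite mulrBr !gr_liftB E E' mulrBr.
by rewrite -grM !gr_lift_gr fM.
Qed.

Lemma gr_mapE (G K : groupType) (f : G -> K) : gr_map f = gr_lift (fun x => gr (f x)).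
Proof.
apply/funext => a; apply: eq_bigr => x _ /=.
exact: monomialE.
Qed.

Section GrMap.
Variables (G K : groupType) (f : G -> K).

Lemma gr_mapB : {morph gr_map f : a b / a - b}.
Proof. by rewrite gr_mapE; exact: gr_liftB. Qed.

HB.instance Definition _ :=
  GRing.isZmodMorphism.Build (groupring G) (groupring K) (gr_map f) gr_mapB.

Lemma gr_map_gr x : gr_map f (gr x) = gr (f x).
Proof. by rewrite gr_mapE gr_lift_gr. Qed.
End GrMap.

(** * Existence of Fox derivatives *)

Section FoxExtension.
Variable G : groupType.

(* The semidirect product of Z[G] and G: a homomorphism G -> Z[G] >< G over the
   identity of G is the same as a crossed homomorphism G -> Z[G]. *)
Definition crossed_ext : Type := (groupring G * G)%type.
HB.instance Definition _ := Choice.on crossed_ext.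

Definition crossed_mul (x y : crossed_ext) : crossed_ext :=
  (x.1 + gr x.2 * y.1, (x.2 * y.2)%g).
Definition crossed_one : crossed_ext := (0, 1%g).
Definition crossed_inv (x : crossed_ext) : crossed_ext :=
  (- (gr x.2^-1%g * x.1), x.2^-1%g).

Lemma crossed_mulA : associative crossed_mul.
Proof.
move=> x y z; rewrite /crossed_mul /=.
by rewrite mulgA grM mulrDr mulrA addrA.
Qed.

Lemma crossed_mul1 : left_id crossed_one crossed_mul.
Proof. by case=> a x; rewrite /crossed_mul /= mul1g gr1 mul1r add0r. Qed.

Lemma crossed_1mul : right_id crossed_one crossed_mul.
Proof. by case=> a x; rewrite /crossed_mul /= mulg1 mulr0 addr0. Qed.

Lemma crossed_mulV : left_inverse crossed_one crossed_inv crossed_mul.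
Proof. by case=> a x; rewrite /crossed_mul /= mulVg addNr. Qed.

Lemma crossed_Vmul : right_inverse crossed_one crossed_inv crossed_mul.
Proof.
case=> a x; rewrite /crossed_mul /= mulgV mulrN mulrA -grM mulgV gr1.
by rewrite mul1r subrr.
Qed.

HB.instance Definition _ := isGroup.Build crossed_ext
  crossed_mulA crossed_mul1 crossed_1mul crossed_mulV crossed_Vmul.

Lemma crossed_snd_multiplicative : {morph (snd : crossed_ext -> G) : x y / (x * y)%g}.
Proof. by []. Qed.

Definition crossed_snd (x : crossed_ext) : G := x.2.
HB.instance Definition _ :=
  monoid.isMultiplicative.Build crossed_ext G crossed_snd crossed_snd_multiplicative.

(** Sending b_j to (delta_ij, b_j) extends to a homomorphism into [crossed_ext] lying over the
    identity; the linear extension of its first component is a Fox derivative. So [xget] in [fox]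
    picks a genuine one, not its default. *)
Lemma foxP (I : eqType) (b : I -> G) (i : I) :
  free_basis b -> is_fox_derivative b i (fox b i).
Proof.
move=> fb; have [[h hb] _] := fb crossed_ext (fun j => ((i == j)%:R, b j)).
have [_ /(_ (crossed_snd \o h) idfun) /= E] := fb G b.
have h2 x : (h x).2 = x by apply: E => j; rewrite hb.
apply: (@xgetPex _ _ [set D | is_fox_derivative b i D]).
exists (gr_lift (fun x => (h x).1)); split.
- exact: raddfD.
- by move=> j; rewrite gr_lift_gr hb.
- by move=> u v; rewrite !gr_lift_gr gmulfM /= h2.
Qed.
End FoxExtension.

(** * Units and determinants over the group ring of a free abelian group *)

Section Augmentation.
Variable G : groupType.

Definition augmentation : groupring G -> int := gr_lift (fun=> 1).
HB.instance Definition _ := GRing.Additive.on augmentation.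

Lemma augmentation_gr x : augmentation (gr x) = 1.
Proof. exact: gr_lift_gr. Qed.

Lemma augmentationM : {morph augmentation : a b / a * b}.
Proof. by apply: gr_lift_monoid => x y; rewrite mulr1. Qed.

Lemma augmentation1 : augmentation 1 = 1.
Proof. by rewrite -gr1 augmentation_gr. Qed.

HB.instance Definition _ := GRing.isMonoidMorphism.Build (groupring G) int
  augmentation (conj augmentation1 augmentationM).
End Augmentation.

Section GrLog.
Variable M : zmodType.
Notation ZM := (groupring (GRing.to_multiplicative M)).

(* This vanishes on I^2, for I the augmentation ideal, and inverts the isomorphism
   M -> I / I^2 sending x to x - 1. *)
Definition gr_log : ZM -> M :=
  @gr_lift (GRing.to_multiplicative M) M (fun x : GRing.to_multiplicative M => x).
HB.instance Definition _ := GRing.Additive.on gr_log.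

Lemma gr_log_gr (x : M) : gr_log (gr (x : GRing.to_multiplicative M)) = x.
Proof. exact: (@gr_lift_gr (GRing.to_multiplicative M) M). Qed.

Lemma gr_logB : {morph gr_log : a b / a - b}.
Proof. exact: gr_liftB. Qed.

(** A Leibniz rule over the augmentation: by biadditivity it suffices to check group elements, where
    both sides are x + y. *)
Lemma gr_logM (a b : ZM) :
  gr_log (a * b) = gr_log a *~ augmentation b + gr_log b *~ augmentation a.
Proof.
elim/gr_ind: a => [a a' E E'|x].
  rewrite mulrBl !gr_logB E E' (raddfB (@augmentation _)) mulrzBr mulrzBl /=.
  by rewrite addrACA opprD.
elim/gr_ind: b => [b b' E E'|y].
  rewrite mulrBr !gr_logB E E' (raddfB (@augmentation _)) mulrzBr mulrzBl /=.
  by rewrite addrACA opprD.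
by rewrite -grM !gr_log_gr !augmentation_gr !mulr1z.
Qed.

Lemma gr_log_prod (I : finType) (F : I -> ZM) :
  gr_log (\prod_i F i) =
  \sum_i gr_log (F i) *~ \prod_(j | j != i) augmentation (F j).
Proof.
(* Removing [i] from a list instead of restricting by j != i allows induction on duplicate-free
   lists. *)
pose L (r : seq I) := \sum_(i <- r) gr_log (F i) *~ \prod_(j <- rem i r) augmentation (F j).
have E r : uniq r -> gr_log (\prod_(i <- r) F i) = L r.
  elim: r => [_|i r IH /= /andP[ir ur]].
    by rewrite /L !big_nil -gr1 gr_log_gr.
  rewrite big_cons gr_logM IH // /L big_cons /= eqxx addrC.
  rewrite (big_morph _ (@augmentationM _) (@augmentation1 _)) addrC; congr (_ + _).
  rewrite mulrz_suml; apply: eq_big_seq => j jr /=.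
  case: eqP ir => [->|_ _]; first by rewrite jr.
  by rewrite big_cons mulrC mulrzA.
have u := index_enum_uniq I.
rewrite E // /L; apply: eq_big_seq => i _; congr (_ *~ _).
by rewrite (rem_filter _ u) big_filter.
Qed.

(** A nontrivial permutation moves at least two indices, so its product has two factors of
    augmentation 0 and lies in I^2, where [gr_log] vanishes. Only the diagonal product remains, with
    factors of augmentation 1. *)
Lemma gr_log_det n (A : 'M[ZM]_n) :
  map_mx (@augmentation _) A = 1%:M -> gr_log (\det A) = \sum_i gr_log (A i i).
Proof.
move=> A1; have Ae i j : augmentation (A i j) = (i == j)%:R.
  by have /matrixP/(_ i j) := A1; rewrite !mxE.
rewrite /determinant raddf_sum /= (bigD1 (1%g : 'S_n)) //= [X in _ + X]big1 ?addr0 => [|s s1].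
  rewrite odd_perm1 expr0 mul1r gr_log_prod; apply: eq_bigr => i _.
  rewrite big1 ?mulr1z ?perm1 // => j _.
  by rewrite perm1 Ae eqxx.
have [i si] : exists i, s i != i.
  apply/existsP; apply: contraNT s1 => /existsPn s1.
  by apply/eqP/permP => i; rewrite perm1; apply/eqP/negbNE/s1.
suff P0 : gr_log (\prod_j A j (s j)) = 0.
  by case: (odd_perm s); rewrite ?expr1 ?expr0 ?mulN1r ?mul1r // raddfN /= P0 oppr0.
rewrite gr_log_prod big1 // => k _.
(* Omitting the factor [k] leaves another moved index: [i] if it differs from [k], and [s i]
   otherwise. *)
have [j jk sj] : exists2 j, j != k & s j != j.
  have [eik|nik] := eqVneq i k; last by exists i.
  by exists (s i); rewrite -?eik // (inj_eq perm_inj).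
by rewrite (bigD1 j) //= Ae eq_sym (negbTE sj) mul0r mulr0z.
Qed.
End GrLog.

(** * Units of augmentation 1 in the group ring *)

Section TrivialUnits.
Variable M : zmodType.
Notation ZM := (groupring (GRing.to_multiplicative M)).
Notation supp := (msupp : ZM -> {fset M}).

Lemma mcoeff_gr_mul (a b : ZM) (z : M) : (a * b : ZM)@_z =
  \sum_(x <- supp a) \sum_(y <- supp b) (a@_x * b@_y) *+ (x + y == z).
Proof.
rewrite [a * b]/(gr_mul a b) /gr_mul raddf_sum /=; apply: eq_bigr => x _.
by rewrite raddf_sum /=; apply: eq_bigr => y _; rewrite mcoeffU.
Qed.

(** Leading terms do not cancel: if x + y = x0 + y0, maximality forces lam x = lam x0, so x = x0 by
    injectivity and then y = y0. *)
Lemma mcoeff_gr_mul_max (lam : M -> int) (a b : ZM) (x0 y0 : M) :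
  {morph lam : x y / x + y} -> {in supp a &, injective lam} ->
  x0 \in supp a -> y0 \in supp b ->
  (forall x, x \in supp a -> lam x <= lam x0) ->
  (forall y, y \in supp b -> lam y <= lam y0) ->
  (a * b : ZM)@_(x0 + y0) = a@_x0 * b@_y0.
Proof.
move=> lamD inj ax0 by0 mx my; rewrite mcoeff_gr_mul.
have E x y : x \in supp a -> y \in supp b -> x + y = x0 + y0 -> x = x0.
  move=> ax by_ exy; apply: inj => //; apply/eqP; rewrite eq_le mx //=.
  have := congr1 lam exy; rewrite !lamD => e.
  by rewrite -(lerD2r (lam y0)) -e lerD2l my.
rewrite (bigD1_seq x0) ?fset_uniq //= (bigD1_seq y0) ?fset_uniq //= eqxx mulr1n.
rewrite !big1_seq ?addr0 // => [x /andP[nx ax]|y /andP[ny _]].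
  rewrite big1_seq // => y /andP[_ by_]; case: eqP => // /(E _ _ ax by_) ex.
  by rewrite ex eqxx in nx.
by case: eqP => // /addrI ey; rewrite ey eqxx in ny.
Qed.

Lemma seq_argmax (T : eqType) (lam : T -> int) (s : seq T) : s != [::] ->
  exists2 x, x \in s & forall y, y \in s -> lam y <= lam x.
Proof.
elim: s => // x [|y s] IH _.
  by exists x; rewrite ?mem_head // => y; rewrite inE => /eqP->.
have [//|z zs zmax] := IH; have [xz|zx] := leP (lam x) (lam z).
  by exists z => [|w]; rewrite inE ?zs ?orbT // => /orP[/eqP->|/zmax].
exists x => [|w]; first exact: mem_head.
by rewrite inE => /orP[/eqP->//|/zmax/le_trans]; apply; exact: ltW.
Qed.

(* Evaluate sum_i c_i(x) X^i at an integer which is not a root of the polynomials of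
   the nonzero differences of elements of s. *)
Lemma separating_functional n (c : 'I_n -> M -> int) (s : seq M) :
  (forall i, {morph c i : x y / x + y}) -> (forall x, (forall i, c i x = 0) -> x = 0) ->
  exists2 lam : M -> int, {morph lam : x y / x + y} & {in s &, injective lam}.
Proof.
move=> cD cinj.
pose p x : {poly int} := \poly_(i < n) (if insub i is Some j then c j x else 0).
have pE x (i : 'I_n) : (p x)`_i = c i x by rewrite coef_poly ltn_ord valK.
have pD : {morph p : x y / x + y}.
  move=> x y; apply/polyP => i; rewrite coefD !coef_poly; case: ltnP => // lin.
  by rewrite insubT cD.
have p0 x : p x = 0 -> x = 0.
  by move=> px; apply: cinj => i; rewrite -pE px coef0.
have pB x y : p (x - y) = p x - p y.
  by apply: (@addIr _ (p y)); rewrite -pD !subrK.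
pose P := \prod_(d <- [seq x - y | x <- s, y <- s] | d != 0) p d.
have P0 : P != 0.
  by rewrite prodf_seq_neq0; apply/allP => d _; apply/implyP; apply: contra_neq => /p0.
(* A nonzero polynomial has fewer roots than its size, so the integers from 0 to [size P] - 1 cannot
   all be roots. *)
have [N PN] : exists N : int, P.[N] != 0.
  apply: contrapT => /forallNP h.
  have := @max_poly_roots _ P [seq i%:Z | i <- iota 0 (size P)] P0.
  rewrite size_map size_iota ltnn map_inj_uniq ?iota_uniq; last by move=> ? ? [].
  suff rts : all (root P) [seq i%:Z | i <- iota 0 (size P)] by move=> /(_ rts isT).
  apply/allP => _ /mapP[i _ ->].
  by rewrite /root; apply/negPn/negP/h.
exists (fun x => (p x).[N]) => [x y|x y xs ys /eqP].
  by rewrite pD hornerD.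
rewrite -subr_eq0 -hornerN -hornerD -pB => e; apply/eqP; rewrite -subr_eq0.
apply: contraNT PN => nxy; rewrite horner_prod prodf_seq_eq0.
by apply/hasP; exists (x - y); rewrite ?nxy //; apply/allpairsP; exists (x, y).
Qed.

(** The [c i] embed M in Z^n. For a functional separating the support of u, the top and bottom terms
    of u v survive; as u v = 1 they both sit at 0, so the support of u has width 0 and is one
    point. *)
Lemma gr_unit_trivial n (c : 'I_n -> M -> int) (u v : ZM) :
  (forall i, {morph c i : x y / x + y}) -> (forall x, (forall i, c i x = 0) -> x = 0) ->
  u * v = 1 -> augmentation u = 1 ->
  exists h : M, u = gr (h : GRing.to_multiplicative M).
Proof.
move=> cD cinj uv1 u1.
have [lam lamD inj] := @separating_functional _ c (supp u) cD cinj.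
have supp0 (w : ZM) : w != 0 -> supp w != [::] :> seq M.
  by apply: contra_neq => sw; rewrite [w]monalgE sw big_nil.
have u0 : supp u != [::] :> seq M.
  by apply: supp0; apply: contra_eq_neq uv1 => ->; rewrite mul0r eq_sym oner_eq0.
have v0 : supp v != [::] :> seq M.
  by apply: supp0; apply: contra_eq_neq uv1 => ->; rewrite mulr0 eq_sym oner_eq0.
have sum0 x y : x \in supp u -> y \in supp v ->
    (u * v : ZM)@_(x + y) = u@_x * v@_y -> x + y = 0.
  rewrite uv1 => ux vy; rewrite [LHS]mcoeffU.
  case: eqP => [<-//|_] /esym/eqP; rewrite mulf_eq0 !mcoeff_eq0.
  by rewrite ux vy.
have [x0 ux0 mx0] := seq_argmax lam u0.
have [y0 vy0 my0] := seq_argmax lam v0.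
have [x1 ux1 mx1] := seq_argmax (fun x => - lam x) u0.
have [y1 vy1 my1] := seq_argmax (fun x => - lam x) v0.
have e0 := sum0 _ _ ux0 vy0 (mcoeff_gr_mul_max lamD inj ux0 vy0 mx0 my0).
have NlamD : {morph (fun x => - lam x) : x y / x + y} by move=> x y; rewrite lamD opprD.
have Ninj : {in supp u &, injective (fun x => - lam x)}.
  by move=> x y ux uy /oppr_inj/inj; apply.
have e1 := sum0 _ _ ux1 vy1 (mcoeff_gr_mul_max NlamD Ninj ux1 vy1 mx1 my1).
(* From lam x0 + lam y0 = lam x1 + lam y1 with lam x1 <= lam x0 and lam y1 <= lam y0, [lam] is
   constant on the support of u. *)
have ux x : x \in supp u -> x = x0.
  move=> ux; apply: inj => //.
  have := congr1 lam (etrans e0 (esym e1)); rewrite !lamD => e.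
  have := mx0 _ ux; have := mx1 _ ux; have := my1 _ vy0; have := mx0 _ ux1; rewrite !lerN2.
  by lia.
exists x0; have ue : u = mkmalgU x0 u@_x0.
  rewrite {1}[u]monalgE (bigD1_seq x0) ?fset_uniq //= big1_seq ?addr0 // => x /andP[nx /ux ex].
  by rewrite ex eqxx in nx.
have uz : u = gr (x0 : GRing.to_multiplicative M) *~ u@_x0.
  by rewrite {1}ue; exact: (@monomialE (GRing.to_multiplicative M)).
by move: u1; rewrite uz raddfMz /= augmentation_gr intz => ->.
Qed.
End TrivialUnits.

(** * Tensors and the second graded piece of the lower central series *)

Section MorphD.
Variables (U V : zmodType) (f : U -> V).
Hypothesis fD : {morph f : x y / x + y}.

(** This section serves maps such as [tens_lift b], additive only given a proof that b is
    biadditive. *)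
Lemma morphD0 : f 0 = 0.
Proof. by apply: (@addrI _ (f 0)); rewrite -fD !addr0. Qed.

Lemma morphDN : {morph f : x / - x}.
Proof. by move=> x; apply: (@addrI _ (f x)); rewrite -fD !subrr morphD0. Qed.

Lemma morphD_sum (I : Type) (r : seq I) (P : pred I) (F : I -> U) :
  f (\sum_(i <- r | P i) F i) = \sum_(i <- r | P i) f (F i).
Proof. exact: (big_morph f fD morphD0). Qed.

Lemma morphDMz n : {morph f : x / x *~ n}.
Proof.
have fMn k x : f (x *+ k) = f x *+ k.
  by elim: k => [|k IH]; rewrite ?mulr0n ?morphD0 // !mulrS fD IH.
by case: n => n x; rewrite ?NegzE ?mulrNz -?pmulrn ?morphDN fMn.
Qed.
End MorphD.

Section TensorFacts.
Variables M N : zmodType.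

Lemma tensDl (n : N) : {morph (fun m : M => tens m n) : x y / x + y}.
Proof. exact: (tens_biadditive M N).1. Qed.

Lemma tensDr (m : M) : {morph (fun n : N => tens m n) : x y / x + y}.
Proof. exact: (tens_biadditive M N).2. Qed.

Lemma tens_ind (P : tensor M N -> Prop) : P 0 ->
  (forall x y, P x -> P y -> P (x + y)) -> (forall m n, P (tens m n)) -> forall x, P x.
Proof.
move=> P0 PD Pt x; have [s ->] := tens_surj x; elim: s => [|[m n] s IH]; first exact: P0.
by rewrite -cat1s tens_class_cat; apply: PD => //; exact: Pt.
Qed.

End TensorFacts.

Section Gr2.
Variable G : groupType.
Implicit Types (x y : G) (l : lie2 (abel G)).

Lemma ab1 : ab (1%g : G) = 0. Proof. by []. Qed.

Lemma abV x : ab x^-1%g = - ab x.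
Proof. by apply/esym; exact: ab_opp. Qed.

Lemma ab_comm x y : ab [~ x, y]%g = 0.
Proof. by rewrite /commg /conjg !abM !abV addrCA addKr addNr. Qed.

(** A homomorphism to an abelian group kills commutators, so it factors through the
    abelianization. *)
Lemma additive_ab (P : zmodType) (f : G -> P) : {morph f : x y / (x * y)%g >-> x + y} ->
  forall x y, ab x = ab y -> f x = f y.
Proof.
move=> fD; have f1 : f 1%g = 0 by apply: (@addrI _ (f 1%g)); rewrite -fD mulg1 addr0.
have fV x : f x^-1%g = - f x by apply/eqP; rewrite -addr_eq0 -fD mulVg f1.
have f2 x : lower_central G 2 x -> f x = 0.
  elim=> [|_ [z _ [w _ <-]]|z w _ hz _ hw|z _ hz]; first exact: f1.
  - by rewrite /commg /conjg !fD !fV addrCA addKr addNr.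
  - by rewrite fD hz hw addr0.
  - by rewrite fV hz oppr0.
by move=> x y /eqP/ab_eqP/f2/eqP; rewrite fD fV subr_eq0 => /eqP.
Qed.

Lemma ab_lower_central2 x : lower_central G 2 x -> ab x = 0.
Proof.
elim=> [|_ [y _ [z _ <-]]|y z _ hy _ hz|y _ hy]; first exact: ab1.
- exact: ab_comm.
- by rewrite abM hy hz addr0.
- by rewrite abV hy oppr0.
Qed.

Lemma gr2_ab x l : gr2 x l -> ab x = 0.
Proof.
elim=> [|y z|y z a b _ hy _ hz|y a _ hy]; first exact: ab1.
- exact: ab_comm.
- by rewrite abM hy hz addr0.
- by rewrite abV hy oppr0.
Qed.

Lemma lie2_bracket0 (a : abel G) : lie2_bracket a 0 = 0.
Proof.
apply: val_inj; rewrite /= /bracket (morphD0 (tensDr a)) (morphD0 (tensDl a)).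
by rewrite subr0.
Qed.

Lemma gr2_lower_central2 x : lower_central G 2 x -> exists l, gr2 x l.
Proof.
elim=> [|_ [y _ [z _ <-]]|y z _ [a ya] _ [b zb]|y _ [a ya]].
- by exists 0; exact: gr2_1.
- by exists (lie2_bracket (ab y) (ab z)); exact: gr2_comm.
- by exists (a + b); exact: gr2_M.
- by exists (- a); exact: gr2_V.
Qed.

(** A generator is a commutator with an element of Gamma_2, whose class in the abelianization is 0,
    so its bracket vanishes. *)
Lemma gr2_lower_central3 x : lower_central G 3 x -> gr2 x 0.
Proof.
elim=> [|_ [y _ [z hz <-]]|y z _ hy _ hz|y _ hy]; first exact: gr2_1.
- have <- : lie2_bracket (ab y) (ab z) = 0.
    by rewrite (ab_lower_central2 hz) lie2_bracket0.
  exact: gr2_comm.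
- by rewrite -[0]addr0; exact: gr2_M.
- by rewrite -oppr0; exact: gr2_V.
Qed.

(** Conjugation multiplies x by a commutator with x^-1, whose bracket vanishes because [ab x] =
    0. *)
Lemma gr2_conj x y l : gr2 x l -> gr2 (y * x * y^-1)%g l.
Proof.
move=> xl; have -> : (y * x * y^-1 = [~ y^-1, x^-1] * x)%g.
  by rewrite /commg /conjg !invgK !mulgA mulgVK.
have <- : lie2_bracket (ab y^-1%g) (ab x^-1%g) + l = l.
  by rewrite (abV x) (gr2_ab xl) oppr0 lie2_bracket0 add0r.
by apply: gr2_M => //; exact: gr2_comm.
Qed.

Lemma lower_centralS k x : lower_central G k.+2 x -> lower_central G k.+1 x.
Proof.
elim: k x => [//|k IH] x; elim=> [|_ [y _ [z hz <-]]|y z _ hy _ hz|y _ hy].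
- exact: generated1.
- by apply: generated_in; exists y => //; exists z => //; exact: IH.
- exact: generatedM.
- exact: generatedV.
Qed.

Lemma lower_central_le k m x : (0 < k <= m)%N ->
  lower_central G m x -> lower_central G k x.
Proof.
case: k => // k /= /subnK <-; elim: (m - _)%N => // n IH.
by rewrite addSn addnS => /lower_centralS; rewrite -addnS.
Qed.
End Gr2.

Section Gr2Map.
Variables (G K : groupType) (f : {multiplicative G -> K}).

Lemma lie2_mapD (M N : zmodType) (h : {additive M -> N}) :
  {morph lie2_map h : x y / x + y}.
Proof. by move=> x y; apply: val_inj; exact: (tens_liftD (tens_map_biadditive h)). Qed.

Lemma gr2_morph x l : gr2 x l -> gr2 (f x) (lie2_map (abel_map f) l).
Proof.
elim=> [|y z|y z a b _ hy _ hz|y a _ hy].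
- by rewrite gmulf_one (morphD0 (@lie2_mapD _ _ _)); exact: gr2_1.
- have -> : lie2_map (abel_map f) (lie2_bracket (ab y) (ab z)) =
      lie2_bracket (ab (f y)) (ab (f z)).
    have tb := tens_map_biadditive (abel_map f); apply: val_inj => /=.
    rewrite /bracket /tens_map (tens_liftD tb) (morphDN (tens_liftD tb)).
    by rewrite !tens_lift_tens //= !abel_mapE.
  by rewrite /commg /conjg !gmulfM !gmulf_inv; exact: gr2_comm.
- by rewrite gmulfM lie2_mapD; exact: gr2_M.
- by rewrite gmulf_inv (morphDN (@lie2_mapD _ _ _)); exact: gr2_V.
Qed.
End Gr2Map.

(** * The determinant of the Magnus matrix *)

Lemma gr_map_monoid (G K : groupType) (f : G -> K) :
  f 1%g = 1%g -> {morph f : x y / (x * y)%g} ->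
  {morph gr_map f : a b / a * b}.
Proof.
move=> f1 fM; rewrite gr_mapE; apply: gr_lift_monoid => x y.
by rewrite fM grM.
Qed.

Section Crossed.
Variables (G : groupType) (g : nat) (b : 'I_g -> G).
Hypothesis fb : free_basis b.
Notation M := (abel G).
Notation ZM := (groupring (GRing.to_multiplicative (abel G))).
Notation grab x := (gr (ab x : GRing.to_multiplicative (abel G)) : ZM).

(** The product rule satisfied by abelianized Fox derivatives, with values in a commutative ring. *)
Definition crossed (e : G -> ZM) : Prop := forall x y, e (x * y)%g = e x + grab x * e y.

Lemma crossed1 e : crossed e -> e 1%g = 0.
Proof. by move=> ec; apply: (@addrI _ (e 1%g)); rewrite -{3}(mulg1 1%g) ec mul1r addr0. Qed.

Lemma crossedV e x : crossed e -> e x^-1%g = - (grab x^-1%g * e x).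
Proof. by move=> ec; apply/eqP; rewrite -addr_eq0 -ec mulVg crossed1. Qed.

Lemma crossed_eq e e' : crossed e -> crossed e' -> (forall k, e (b k) = e' (b k)) ->
  e =1 e'.
Proof.
move=> ec ec' E; apply: (free_basis_ind fb) => [|//|x y ex ey|x ex].
- by rewrite (crossed1 ec) (crossed1 ec').
- by rewrite ec ec' ex ey.
- by rewrite (crossedV _ ec) (crossedV _ ec') ex.
Qed.

Variable d : 'I_g -> G -> ZM.
Hypothesis dc : forall j, crossed (d j).
Hypothesis db : forall j k, d j (b k) = (j == k)%:R.

(** The coordinate of a along the class of b_j: the augmentation of the Fox derivative counts the
    exponent of b_j. *)
Definition bcoef (j : 'I_g) (a : M) : int := augmentation (d j (repr a)).

Lemma bcoef_ab j x : bcoef j (ab x) = augmentation (d j x).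
Proof.
apply: (additive_ab (f := fun x => augmentation (d j x))) (ab_repr _) => y z.
by rewrite dc raddfD /= augmentationM augmentation_gr mul1r.
Qed.

Lemma bcoefD j : {morph bcoef j : a c / a + c}.
Proof.
move=> a c; have [x ->] := ab_surj a; have [y ->] := ab_surj c; rewrite -abM !bcoef_ab.
by rewrite dc raddfD /= augmentationM augmentation_gr mul1r.
Qed.

Lemma bcoef_basis j k : bcoef j (ab (b k)) = (j == k)%:R.
Proof. by rewrite bcoef_ab db; case: eqP => _; rewrite ?raddf0 ?augmentation1. Qed.

Lemma abel_expand (a : M) : a = \sum_j ab (b j) *~ bcoef j a.
Proof.
have [x ->] := ab_surj a; elim/(free_basis_ind fb): x => [|k|x y IHx IHy|x IHx].
- by rewrite big1 // => j _; rewrite (morphD0 (bcoefD j)) mulr0z.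
- rewrite (bigD1 k) //= bcoef_basis eqxx mulr1z big1 ?addr0 // => j /negbTE jk.
  by rewrite bcoef_basis jk mulr0z.
- rewrite abM [LHS](congr2 +%R IHx IHy) -big_split; apply: eq_bigr => j _ /=.
  by rewrite bcoefD mulrzDr.
- rewrite abV [LHS](congr1 -%R IHx) -sumrN; apply: eq_bigr => j _ /=.
  by rewrite (morphDN (bcoefD j)) mulrNz.
Qed.

Lemma bcoef_inj (a : M) : (forall j, bcoef j a = 0) -> a = 0.
Proof. by move=> h; rewrite [a]abel_expand big1 // => j _; rewrite h mulr0z. Qed.

(** Contraction of the first factor with the dual basis element b_j^*. *)
Definition tens_coef (j : 'I_g) : tensor M M -> M :=
  tens_lift (fun h1 h2 => h2 *~ bcoef j h1).

Lemma bcoef_biadditive j : biadditive (fun h1 h2 : M => h2 *~ bcoef j h1).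
Proof. by split=> [n x y|m x y] /=; rewrite ?bcoefD ?mulrzDr ?mulrzDl. Qed.

Lemma tens_coefD j : {morph tens_coef j : s t / s + t}.
Proof. exact: tens_liftD (bcoef_biadditive j). Qed.

Lemma tens_coef_tens j x y : tens_coef j (tens x y) = y *~ bcoef j x.
Proof. exact: tens_lift_tens (bcoef_biadditive j). Qed.

Lemma tens_coef_inj (t : tensor M M) : (forall j, tens_coef j t = 0) -> t = 0.
Proof.
move=> t0; suff -> : t = \sum_j tens (ab (b j)) (tens_coef j t).
  by rewrite big1 // => j _; rewrite t0 (morphD0 (tensDr _)).
elim/tens_ind: (t) => [|s s' E E'|x y].
- by rewrite big1 // => j _; rewrite (morphD0 (tens_coefD j)) (morphD0 (tensDr _)).
- rewrite [LHS](congr2 +%R E E') -big_split; apply: eq_bigr => j _ /=.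
  by rewrite tens_coefD tensDr.
- rewrite {1}[x]abel_expand (morphD_sum (tensDl y)); apply: eq_bigr => j _.
  by rewrite tens_coef_tens (morphDMz (tensDl y)) (morphDMz (tensDr _)).
Qed.

Lemma gr_log_crossedM j x y : gr_log (d j (x * y)%g) =
  gr_log (d j x) + gr_log (d j y) + ab x *~ bcoef j (ab y).
Proof.
rewrite dc raddfD /= gr_logM gr_log_gr augmentation_gr mulr1z.
by rewrite bcoef_ab addrAC addrA.
Qed.

Lemma gr_log_crossed1 j : gr_log (d j 1%g) = 0.
Proof. by rewrite (crossed1 (@dc j)) raddf0. Qed.

Lemma gr_log_crossedV j x : gr_log (d j x^-1%g) =
  - gr_log (d j x) + ab x *~ bcoef j (ab x).
Proof.
have := gr_log_crossedM j x^-1%g x; rewrite mulVg gr_log_crossed1 abV mulNrz.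
move=> e; apply/eqP; rewrite -subr_eq0 e; apply/eqP.
by rewrite opprD opprK addrA.
Qed.

(* Modulo I^2, the abelianized Fox derivatives of a product of commutators read
   off its class in the degree 2 part of the free Lie ring. *)
Lemma gr2_crossed j x l : gr2 x l -> gr_log (d j x) = - tens_coef j (val l).
Proof.
elim=> [|y z|y z a c ya hy zc hz|y a ya hy].
- by rewrite gr_log_crossed1 (morphD0 (tens_coefD j)) oppr0.
- rewrite /= /bracket tens_coefD (morphDN (tens_coefD j)) !tens_coef_tens.
  (* Expanding both sides of yz = zy[y, z] and cancelling the symmetric part leaves y b_j^*(z) - z
     b_j^*(y). *)
  have e : (y * z = z * y * [~ y, z])%g by rewrite /commg /conjg !mulgA mulgK mulgV mul1g.
  move: (ab_comm y z) e; move: [~ y, z]%g => c c0 e.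
  have := gr_log_crossedM j (z * y)%g c.
  rewrite -e !gr_log_crossedM c0 (morphD0 (bcoefD j)) mulr0z addr0.
  rewrite [gr_log (d j z) + gr_log _]addrC.
  by rewrite opprB -!addrA => /addrI/addrI ->; rewrite [RHS]addrC addKr.
- rewrite gr_log_crossedM hy hz (gr2_ab ya) mul0rz addr0.
  by rewrite raddfD /= tens_coefD opprD.
- by rewrite gr_log_crossedV hy (gr2_ab ya) mul0rz addr0 raddfN /= (morphDN (tens_coefD j)).
Qed.

(** Well-definedness of the class at 1: by [gr2_crossed] the group element determines all
    contractions of l, and these determine l. *)
Lemma gr2_unique l : gr2 (1%g : G) l -> l = 0.
Proof.
move=> l1; apply/val_inj/tens_coef_inj => j; apply/eqP.
rewrite -oppr_eq0 -(gr2_crossed j l1).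
by rewrite gr_log_crossed1.
Qed.

(** Since phi acts trivially on the abelianization, both sides are crossed homomorphisms in x; they
    agree on the basis. *)
Lemma crossed_chain (phi : {multiplicative G -> G}) i x :
  (forall y, ab (phi y) = ab y) ->
  d i (phi x) = \sum_k d k x * d i (phi (b k)).
Proof.
move=> phi1; apply: (@crossed_eq (fun x => d i (phi x))
    (fun x => \sum_k d k x * d i (phi (b k)))) => [y z|y z|k].
- by rewrite gmulfM dc phi1.
- rewrite mulr_sumr -big_split; apply: eq_bigr => k _ /=.
  by rewrite dc mulrDl mulrA.
- rewrite (bigD1 k) //= db eqxx mul1r big1 ?addr0 // => j /negbTE jk.
  by rewrite db jk mul0r.
Qed.

Notation bar := (@gr_bar (GRing.to_multiplicative (abel G)) : ZM -> ZM).

Lemma barB : {morph bar : a c / a - c}.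
Proof. exact: gr_mapB. Qed.

Lemma bar0 : bar 0 = 0.
Proof. exact: raddf0. Qed.

Lemma barD : {morph bar : a c / a + c}.
Proof. exact: raddfD. Qed.

Lemma bar_gr (x : M) :
  bar (gr (x : GRing.to_multiplicative M)) = gr (- x : GRing.to_multiplicative M).
Proof. exact: gr_map_gr. Qed.

Lemma bar_monoid : {morph bar : a c / a * c}.
Proof. by apply: gr_map_monoid => [|x y]; [exact: invg1 | exact: opprD]. Qed.

Lemma augmentation_bar a : augmentation (bar a) = augmentation a.
Proof.
apply: (gr_additive_eq (f := fun a => augmentation (bar a))) => [c e|c e|x].
- by rewrite barB raddfB.
- exact: raddfB.
- by rewrite bar_gr !augmentation_gr.
Qed.

Lemma gr_log_bar a : gr_log (bar a) = - gr_log a.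
Proof.
apply: (gr_additive_eq (f := fun a => gr_log (bar a)) (h := fun a => - gr_log a))
  => [c e|c e|x].
- by rewrite barB gr_logB.
- by rewrite gr_logB opprD.
- by rewrite bar_gr !gr_log_gr.
Qed.

Theorem det_crossed (phi psi : {multiplicative G -> G}) (l : 'I_g -> lie2 M) :
  (forall x, phi (psi x) = x) -> (forall x, ab (phi x) = ab x) ->
  (forall j, gr2 (phi (b j) * (b j)^-1)%g (l j)) ->
  \det (\matrix_(i, j) bar (d i (phi (b j)))) =
  gr (\sum_j tens_coef j (val (l j)) : GRing.to_multiplicative M).
Proof.
move=> phiK phi1 hl.
set A := \matrix_(i, j) _.
have AE i j : A i j = bar (d i (phi (b j))) by rewrite mxE.
(* The matrix of [psi]; the chain rule and commutativity of the ring make it a right inverse of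
   A. *)
pose B : 'M[ZM]_g := \matrix_(i, j) bar (d i (psi (b j))).
have AB : A *m B = 1%:M.
  apply/matrixP => i j; rewrite !mxE.
  have -> : (i == j)%:R = bar (d i (phi (psi (b j)))).
    by rewrite phiK db; case: eqP => _; rewrite ?bar0 // -gr1 bar_gr oppr0.
  rewrite (crossed_chain _ _ phi1).
  rewrite (big_morph bar barD bar0); apply: eq_bigr => k _.
  rewrite [RHS]bar_monoid [RHS]mulrC.
  by congr (_ * _); [exact: AE | exact: mxE].
have A1 : map_mx (@augmentation _) A = 1%:M.
  apply/matrixP => i j; rewrite mxE AE augmentation_bar -bcoef_ab phi1 bcoef_basis.
  by rewrite mxE.
have detAB : \det A * \det B = 1 by rewrite -det_mulmx AB det1.
have detA1 : augmentation (\det A) = 1 by rewrite -det_map_mx A1 det1.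
have [h hA] := gr_unit_trivial bcoefD bcoef_inj detAB detA1.
rewrite hA; congr (gr _); rewrite -[h]gr_log_gr -hA gr_log_det //.
apply: eq_bigr => j _; rewrite AE gr_log_bar.
(* Split off b_j, whose derivative 1 has logarithm 0. The sign from the bar cancels the one in
   [gr2_crossed]. *)
rewrite -[phi (b j)](mulgVK (b j)) gr_log_crossedM (gr2_ab (hl j)) mul0rz addr0.
rewrite db eqxx (gr2_crossed _ (hl j)) opprD opprK.
by rewrite -gr1 gr_log_gr subr0.
Qed.
End Crossed.

Section FoxAbelian.
Variables (G : groupType) (g : nat) (b : 'I_g -> G).
Hypothesis fb : free_basis b.
Notation M := (abel G).
Notation ZM := (groupring (GRing.to_multiplicative (abel G))).
Notation grab x := (gr (ab x : GRing.to_multiplicative (abel G)) : ZM).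

Definition foxab (j : 'I_g) (x : G) : ZM := gr_ab (fox b j (gr x)).

Lemma gr_abM : {morph (@gr_ab G) : a c / a * c}.
Proof. by apply: gr_map_monoid => // x y; exact: abM. Qed.

Lemma gr_abD : {morph (@gr_ab G) : a c / a + c}.
Proof. exact: raddfD. Qed.

Lemma gr_ab_gr x : gr_ab (gr x) = grab x.
Proof. exact: gr_map_gr. Qed.

Lemma foxab_crossed j : crossed (foxab j).
Proof.
move=> x y; have [D1 D2 D3] := foxP j fb.
by rewrite /foxab D3 gr_abD gr_abM gr_ab_gr.
Qed.

Lemma foxab_basis j k : foxab j (b k) = (j == k)%:R.
Proof.
have [D1 D2 D3] := foxP j fb; rewrite /foxab D2.
by case: eqP => _; rewrite ?(morphD0 gr_abD) // -gr1 gr_ab_gr.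
Qed.

(** Moves the bar past abelianization, since [magnus] applies it in the noncommutative ring. *)
Lemma gr_ab_bar (a : groupring G) :
  gr_ab (gr_bar a) = gr_bar (gr_ab a : groupring (GRing.to_multiplicative M)).
Proof.
apply: (gr_additive_eq (f := fun a => gr_ab (gr_bar a))
  (h := fun a => gr_bar (gr_ab a))) => [c e|c e|x].
- by rewrite [gr_bar _](gr_mapB (fun x : G => x^-1%g)); exact: gr_mapB.
- rewrite [gr_ab _]gr_mapB; exact: gr_mapB.
- rewrite [gr_bar _]gr_map_gr gr_ab_gr [gr_ab _]gr_ab_gr abV; exact/esym/gr_map_gr.
Qed.

Theorem det_fox (phi psi : {multiplicative G -> G}) (l : 'I_g -> lie2 M) :
  (forall x, phi (psi x) = x) -> (forall x, ab (phi x) = ab x) ->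
  (forall j, gr2 (phi (b j) * (b j)^-1)%g (l j)) ->
  \det (\matrix_(i, j) gr_ab (gr_bar (fox b i (gr (phi (b j)))))) =
  gr (\sum_j tens_coef foxab j (val (l j)) : GRing.to_multiplicative M).
Proof.
move=> phiK phi1 hl.
rewrite -(det_crossed fb foxab_crossed foxab_basis phiK phi1 hl); congr (\det _).
by apply/matrixP => i j; rewrite !mxE; exact: gr_ab_bar.
Qed.
End FoxAbelian.

(** * The first Johnson homomorphism in symplectic coordinates *)

Section SymplecticExpansion.
Variables (G : groupType) (omega : abel G -> abel G -> int).
Variables (g : nat) (alpha beta : 'I_g -> G).
Hypothesis omega_bi : biadditive omega.
Hypothesis fb : free_basis (join_families alpha beta).
Hypothesis sf : symplectic_family omega alpha beta.
Notation H := (abel G).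

Let omegaDl y : {morph (fun x => omega x y) : x x' / x + x'} := omega_bi.1 y.
Let omegaDr x : {morph omega x : y y' / y + y'} := omega_bi.2 x.

Lemma symplectic_expand (h : H) :
  h = \sum_j ab (alpha j) *~ omega h (ab (beta j)) -
      \sum_j ab (beta j) *~ omega h (ab (alpha j)).
Proof.
have [x ->] := ab_surj h; elim/(free_basis_ind fb): x => [|[k|k]|x y IHx IHy|x IHx].
- by rewrite !big1 ?subr0 // => j _; rewrite (morphD0 (omegaDl _)) mulr0z.
- rewrite (bigD1 k) //= !big1 ?addr0 ?subr0 => [|j _|j /negbTE jk].
  + by have [_ _ -> _] := sf k k; rewrite eqxx mulr1z.
  + by have [-> _ _ _] := sf k j; rewrite mulr0z.
  + by have [_ _ -> _] := sf k j; rewrite eq_sym jk mulr0z.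
- rewrite [X in _ - X](bigD1 k) //= !big1 ?addr0 ?sub0r => [|j /negbTE jk|j _].
  + by have [_ _ _ ->] := sf k k; rewrite eqxx mulrNz mulr1z opprK.
  + by have [_ _ _ ->] := sf k j; rewrite eq_sym jk oppr0 mulr0z.
  + by have [_ -> _ _] := sf k j; rewrite mulr0z.
- rewrite abM [LHS](congr2 +%R IHx IHy) addrACA -opprD -!big_split.
  by congr (_ - _); apply: eq_bigr => j _; rewrite /= omegaDl mulrzDr.
- rewrite abV [LHS](congr1 -%R IHx) opprB addrC -sumrN.
  congr (_ + _); last rewrite -sumrN; rewrite -?sumrN; apply: eq_bigr => j _.
    by rewrite (morphDN (omegaDl _)) mulrNz.
  by rewrite (morphDN (omegaDl _)) mulrNz opprK.
Qed.

(** The isomorphism H (x) L -> Hom(H, L) induced by x -> omega(x, -), evaluated at y. *)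
Definition tens_omega (L : zmodType) (y : H) : tensor H L -> L :=
  tens_lift (fun h l => l *~ omega h y).

Section TensOmega.
Variable L : zmodType.

Lemma omega_scale_biadditive y : biadditive (fun (h : H) (l : L) => l *~ omega h y).
Proof. by split=> [n h h'|h l l'] /=; rewrite ?omegaDl ?mulrzDr ?mulrzDl. Qed.

Lemma tens_omegaD y : {morph @tens_omega L y : s t / s + t}.
Proof. exact: tens_liftD (omega_scale_biadditive y). Qed.

Lemma tens_omega_tens y (h : H) (l : L) : tens_omega y (tens h l) = l *~ omega h y.
Proof. exact: tens_lift_tens (omega_scale_biadditive y). Qed.

Lemma tens_omegaDr (T : tensor H L) : {morph (fun y => tens_omega y T) : y z / y + z}.
Proof.
move=> y z; elim/tens_ind: T => [|s t Es Et|h l].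
- by rewrite !(morphD0 (tens_omegaD _)) addr0.
- by rewrite !tens_omegaD Es Et addrACA.
- by rewrite !tens_omega_tens omegaDr mulrzDr.
Qed.

Lemma tens_symplectic_expand (T : tensor H L) :
  T = \sum_j tens (ab (alpha j)) (tens_omega (ab (beta j)) T) -
      \sum_j tens (ab (beta j)) (tens_omega (ab (alpha j)) T).
Proof.
elim/tens_ind: T => [|s t Es Et|h l].
- by rewrite !big1 ?subr0 // => j _; rewrite (morphD0 (tens_omegaD _)) (morphD0 (tensDr _)).
- rewrite [LHS](congr2 +%R Es Et) addrACA -opprD -!big_split.
  by congr (_ - _); apply: eq_bigr => j _; rewrite /= tens_omegaD tensDr.
- rewrite {1}[h]symplectic_expand tensDl (morphDN (tensDl _)) !(morphD_sum (tensDl _)).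
  by congr (_ - _); apply: eq_bigr => j _;
    rewrite tens_omega_tens (morphDMz (tensDl _)) (morphDMz (tensDr _)).
Qed.

(** Any values on the basis come from a tensor; with [tens_symplectic_expand], this inverts H (x) L
    -> Hom(H, L). *)
Lemma tens_omega_symplectic (u v : 'I_g -> L) k (T := \sum_j tens (ab (alpha j)) (u j) -
    \sum_j tens (ab (beta j)) (v j) : tensor H L) :
  tens_omega (ab (beta k)) T = u k /\ tens_omega (ab (alpha k)) T = v k.
Proof.
have tN y := morphDN (tens_omegaD y); have tS y := morphD_sum (tens_omegaD y).
rewrite /T; split; rewrite tens_omegaD tN !tS.
- rewrite (bigD1 k) //= tens_omega_tens !big1 ?addr0 ?subr0 => [|j _|j /negbTE jk].
  + by have [_ _ -> _] := sf k k; rewrite eqxx mulr1z.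
  + by rewrite tens_omega_tens; have [_ -> _ _] := sf j k; rewrite mulr0z.
  + by rewrite tens_omega_tens; have [_ _ -> _] := sf j k; rewrite jk mulr0z.
- rewrite [X in _ - X](bigD1 k) //= tens_omega_tens !big1 ?addr0 ?sub0r => [|j /negbTE jk|j _].
  + by have [_ _ _ ->] := sf k k; rewrite eqxx mulrNz mulr1z opprK.
  + by rewrite tens_omega_tens; have [_ _ _ ->] := sf j k; rewrite jk oppr0 mulr0z.
  + by rewrite tens_omega_tens; have [-> _ _ _] := sf j k; rewrite mulr0z.
Qed.
End TensOmega.

(** Prescribe T by classes chosen on the basis. The property spreads to all x because f(x) x^-1 is
    multiplicative up to conjugation, which preserves classes. *)
Lemma johnson1_exists (f : {multiplicative G -> G}) :
  (forall x, lower_central G 2 (f x * x^-1)%g) ->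
  exists T : tensor H (lie2 H), forall x, gr2 (f x * x^-1)%g (tens_omega (ab x) T).
Proof.
move=> f2; have fl x : exists l, gr2 (f x * x^-1)%g l by exact: gr2_lower_central2.
have [u hu] := choice (fun j => fl (beta j)); have [v hv] := choice (fun j => fl (alpha j)).
exists (\sum_j tens (ab (alpha j)) (u j) - \sum_j tens (ab (beta j)) (v j)) => x.
set T := (_ - _ : tensor _ _).
elim/(free_basis_ind fb): x => [|[k|k]|x y IHx IHy|x IHx].
- by rewrite gmulf_one mulgV (morphD0 (tens_omegaDr T)); exact: gr2_1.
- by rewrite /= (tens_omega_symplectic u v k).2.
- by rewrite /= (tens_omega_symplectic u v k).1.
- rewrite abM tens_omegaDr gmulfM.
  have -> : (f x * f y * (x * y)^-1 = f x * x^-1 * (x * (f y * y^-1) * x^-1))%g.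
    by rewrite invgM !mulgA mulgVK.
  by apply: gr2_M => //; exact: gr2_conj.
- rewrite abV (morphDN (tens_omegaDr T)) gmulf_inv invgK.
  have -> : ((f x)^-1 * x = x^-1 * (f x * x^-1)^-1 * x^-1^-1)%g.
    by rewrite invgM !invgK !mulgA mulVg mul1g.
  by apply/gr2_conj/gr2_V.
Qed.
End SymplecticExpansion.

(** * The Lagrangian trace *)

Section LagrangianTrace.
Context {R : realType} {S V : topologicalType} {p : S} {q : V}.
Variables (i : pointed_map p q) (omega : H1 R p -> H1 R p -> int) (g : nat).
Variables alpha beta : 'I_g -> pi1 R p.
Notation iota := (pi1_map (R := R) i).
Notation b := (fun k => pi1_map i (beta k)).
Hypothesis omega_bi : biadditive omega.
Hypothesis fb : free_basis (join_families alpha beta).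
Hypothesis sf : symplectic_family omega alpha beta.
Hypothesis iota_alpha : forall k, iota (alpha k) = 1%g.
Hypothesis fb' : free_basis b.
Notation c := (bcoef (foxab b)).
Notation A := (lagrangian R i).
Notation H := (H1 R p).
Notation H' := (H1 R q).

Let omegaDl y : {morph (fun x => omega x y) : x x' / x + x'} := omega_bi.1 y.
Let omegaDr x : {morph omega x : y y' / y + y'} := omega_bi.2 x.
Let cD j : {morph c j : x y / x + y} := bcoefD (foxab_crossed fb') j.
Let c_basis j k : c j (ab (b k)) = (j == k)%:R :=
  bcoef_basis (foxab_crossed fb') (foxab_basis fb') j k.

Lemma pi1_map_surj y : exists x, iota x = y.
Proof.
elim/(free_basis_ind fb'): y => [|k|_ _ [x <-] [y <-]|_ [x <-]].
- by exists 1%g; rewrite gmulf_one.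
- by exists (beta k).
- by exists (x * y)%g; rewrite gmulfM.
- by exists x^-1%g; rewrite gmulf_inv.
Qed.

Lemma H1_map_ab x : H1_map R i (ab x) = ab (iota x).
Proof. exact: abel_mapE. Qed.

Lemma H1_mapD : {morph H1_map R i : x y / x + y}.
Proof. exact: raddfD. Qed.

Lemma lagrangian_eq0 (a : A) : H1_map R i (val a) = 0.
Proof. by apply/eqP; exact: (valP a). Qed.

(** Projecting the symplectic expansion of a to H' kills the alpha part and leaves a vanishing
    combination of the independent classes of the beta_j'. *)
Lemma omega_lagrangian_alpha (a : A) k : omega (val a) (ab (alpha k)) = 0.
Proof.
have := lagrangian_eq0 a; set x := val a => x0.
have E := congr1 (H1_map R i) (symplectic_expand omega_bi fb sf x).
rewrite x0 H1_mapD (morphDN H1_mapD) !(morphD_sum H1_mapD) in E.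
rewrite big1 ?sub0r in E; last first.
  by move=> j _; rewrite (morphDMz H1_mapD) H1_map_ab iota_alpha ab1 mul0rz.
move/eqP: E; rewrite eq_sym oppr_eq0 => /eqP E.
have := congr1 (c k) E; rewrite (morphD_sum (cD k)) (morphD0 (cD k)) (bigD1 k) //= big1.
  by rewrite (morphDMz H1_mapD) (morphDMz (cD k)) H1_map_ab c_basis eqxx addr0 intz.
move=> j /negbTE jk.
by rewrite (morphDMz H1_mapD) (morphDMz (cD k)) H1_map_ab c_basis eq_sym jk mul0rz.
Qed.

Lemma omega_lagrangian (a a' : A) : omega (val a) (val a') = 0.
Proof.
rewrite [val a'](symplectic_expand omega_bi fb sf) omegaDr (morphDN (omegaDr _)).
rewrite !(morphD_sum (omegaDr _)) !big1 ?subr0 // => j _.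
  by rewrite omega_lagrangian_alpha mulr0z (morphD0 (omegaDr _)).
by rewrite (morphDMz (omegaDr _)) omega_lagrangian_alpha mul0rz.
Qed.

(** The lift picked by [xget] may be replaced by the one with coordinates along the beta_j: they
    differ by an element of A, and A is isotropic. *)
Lemma omega'E (a : A) (h' : H') :
  omega' omega a h' = \sum_j c j h' * omega (val a) (ab (beta j)).
Proof.
pose s := \sum_j ab (beta j) *~ c j h' : H.
have s_lift : H1_map R i s = h'.
  rewrite (morphD_sum H1_mapD) [RHS](abel_expand fb' (foxab_crossed fb') (foxab_basis fb')).
  by apply: eq_bigr => j _; rewrite (morphDMz H1_mapD) H1_map_ab.
rewrite /omega'; set h := xget _ _.
have hP : H1_map R i h = h'.
  by apply: (@xgetPex _ _ [set h | H1_map R i h = h']); exists s.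
have kP : h - s \in kernel_pred (H1_map R i).
  by rewrite unfold_in H1_mapD (morphDN H1_mapD) s_lift hP subrr.
have := omega_lagrangian a (Kernel kP).
rewrite /= omegaDr (morphDN (omegaDr _)) => /eqP; rewrite subr_eq0 => /eqP ->.
rewrite /s (morphD_sum (omegaDr _)); apply: eq_bigr => j _.
by rewrite (morphDMz (omegaDr _)) mulrzz mulrC.
Qed.

(** Extends the contraction from A (x) L_2(H') to H (x) L_2(H'). Hence the trace does not depend on
    which preimage [xget] picks in [lagrangian_trace]. *)
Definition trace_ext : tensor H (lie2 H') -> H' :=
  tens_lift (fun h l => \sum_j tens_coef (foxab b) j (val l) *~ omega h (ab (beta j))).

Lemma trace_ext_biadditive : biadditive (fun (h : H) (l : lie2 H') =>
  \sum_j tens_coef (foxab b) j (val l) *~ omega h (ab (beta j))).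
Proof.
split=> [l h h'|h l l'] /=; rewrite -big_split; apply: eq_bigr => j _ /=.
  by rewrite omegaDl mulrzDr.
by rewrite (tens_coefD (foxab_crossed fb')) mulrzDl.
Qed.

Lemma trace_extD : {morph trace_ext : s t / s + t}.
Proof. exact: tens_liftD trace_ext_biadditive. Qed.

Lemma trace_ext_tens h l : trace_ext (tens h l) =
  \sum_j tens_coef (foxab b) j (val l) *~ omega h (ab (beta j)).
Proof. exact: tens_lift_tens trace_ext_biadditive. Qed.

Lemma contractionE (t : tensor A (lie2 H')) :
  Defs.contraction omega t = trace_ext (tens_map val id t).
Proof.
have inner (a : A) (s : tensor H' H') :
    tens_lift (fun h1 h2 => h2 *~ omega' omega a h1) s =
    \sum_j tens_coef (foxab b) j s *~ omega (val a) (ab (beta j)).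
  have bi : biadditive (fun h1 h2 : H' => h2 *~ omega' omega a h1).
    split=> [n x y|m x y] /=; last by rewrite mulrzDl.
    rewrite -mulrzDr !omega'E -big_split; congr (_ *~ _); apply: eq_bigr => j _ /=.
    by rewrite cD mulrDl.
  have tD j := tens_coefD (foxab_crossed fb') j.
  elim/tens_ind: s => [|s s' Es Et|x y].
  - by rewrite (morphD0 (tens_liftD bi)) big1 // => j _; rewrite (morphD0 (tD j)) mul0rz.
  - rewrite (tens_liftD bi) Es Et -big_split; apply: eq_bigr => j _ /=.
    by rewrite tD mulrzDl.
  - rewrite tens_lift_tens // omega'E mulrz_sumr; apply: eq_bigr => j _.
    by rewrite (tens_coef_tens (foxab_crossed fb')) mulrzA.
have biA : biadditive (fun (a : A) (l : lie2 H') => tens (val a) l).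
  by split=> [n x y|m x y] /=; [exact: tensDl | exact: tensDr].
rewrite /Defs.contraction.
have -> : (fun (a : A) (l : lie2 H') =>
    tens_lift (fun h1 h2 => h2 *~ omega' omega a h1) (val l)) =
  (fun a l => \sum_j tens_coef (foxab b) j (val l) *~ omega (val a) (ab (beta j))).
  by apply/funext => a; apply/funext => l; exact: inner.
have bi : biadditive (fun (a : A) (l : lie2 H') =>
    \sum_j tens_coef (foxab b) j (val l) *~ omega (val a) (ab (beta j))).
  by split=> [l h h'|h l l'] /=; [exact: trace_ext_biadditive.1|exact: trace_ext_biadditive.2].
elim/tens_ind: t => [|s t Es Et|a l].
- rewrite (morphD0 (tens_liftD bi)) /tens_map (morphD0 (tens_liftD biA)).
  by rewrite (morphD0 trace_extD).
- by rewrite (tens_liftD bi) /tens_map (tens_liftD biA) trace_extD Es Et.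
- by rewrite tens_lift_tens // /tens_map tens_lift_tens // trace_ext_tens.
Qed.

Lemma lie2_map_biadditive :
  biadditive (fun (h : H) (l : lie2 H) => tens h (lie2_map (H1_map R i) l)).
Proof.
by split=> [n x y|m x y] /=; [exact: tensDl | rewrite lie2_mapD; exact: tensDr].
Qed.

Lemma trace_ext_map (T : tensor H (lie2 H)) :
  trace_ext (tens_map id (lie2_map (H1_map R i)) T) =
  \sum_j tens_coef (foxab b) j (val (lie2_map (H1_map R i)
     (tens_omega omega (ab (beta j)) T))).
Proof.
have lD := @lie2_mapD _ _ (H1_map R i).
have tD j := tens_coefD (foxab_crossed fb') j.
have oD j := @tens_omegaD _ _ omega_bi (lie2 H) (ab (beta j)).
have uD j :
    {morph (fun l => tens_coef (foxab b) j (val (lie2_map (H1_map R i) l))) : x y / x + y}.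
  by move=> x y; rewrite lD raddfD /= tD.
elim/tens_ind: T => [|s t Es Et|h l].
- rewrite /tens_map (morphD0 (tens_liftD lie2_map_biadditive)) (morphD0 trace_extD).
  by rewrite big1 // => j _; rewrite (morphD0 (oD j)) (morphD0 (uD j)).
- rewrite /tens_map (tens_liftD lie2_map_biadditive) trace_extD Es Et -big_split.
  by apply: eq_bigr => j _ /=; rewrite oD; exact/esym/uD.
- rewrite /tens_map (tens_lift_tens _ _ lie2_map_biadditive) trace_ext_tens.
  apply: eq_bigr => j _; rewrite (tens_omega_tens omega_bi).
  exact/esym/(morphDMz (uD j)).
Qed.

Lemma lagrangian_traceE (T : tensor H (lie2 H)) :
  (forall k, lie2_map (H1_map R i) (tens_omega omega (ab (alpha k)) T) = 0) ->
  lagrangian_trace i omega T =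
  \sum_j tens_coef (foxab b) j (val (lie2_map (H1_map R i)
     (tens_omega omega (ab (beta j)) T))).
Proof.
move=> Ta; rewrite -trace_ext_map /lagrangian_trace contractionE; congr trace_ext.
set P := [set t | _].
apply: (@xgetPex _ _ P).
have aP k : ab (alpha k) \in kernel_pred (H1_map R i).
  by rewrite unfold_in H1_map_ab iota_alpha ab1.
(* By [Ta] the beta half of the expansion of T dies in H (x) L_2(H'), and the alpha_j lie in A. *)
exists (\sum_j tens (Kernel (aP j)) (lie2_map (H1_map R i)
  (tens_omega omega (ab (beta j)) T))).
have biA : biadditive (fun (a : A) (l : lie2 H') => tens (val a) l).
  by split=> [n x y|m x y] /=; [exact: tensDl | exact: tensDr].
have biL := lie2_map_biadditive.
rewrite /P /= [in RHS](tens_symplectic_expand omega_bi fb sf T) /tens_map.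
rewrite [RHS](tens_liftD biL) (morphDN (tens_liftD biL)) !(morphD_sum (tens_liftD biL)).
rewrite (morphD_sum (tens_liftD biA)) [X in _ - X]big1 ?subr0 => [|j _].
  by apply: eq_bigr => j _; rewrite !tens_lift_tens.
by rewrite tens_lift_tens // Ta (morphD0 (tensDr _)).
Qed.
End LagrangianTrace.

(** * The action on the fundamental group of the handlebody *)

Lemma pi1_map_can (R : realType) (X : topologicalType) (q : X) (f f' : pointed_map q q) :
  (forall x, f (f' x) = x) -> forall x : pi1 R q, pi1_map f (pi1_map f' x) = x.
Proof.
move=> fK x; have [c ->] := loop_class_surj x; rewrite /= !pi1_mapE.
by apply/loop_classP/homotopic_ext => t; exact: fK.
Qed.

(** The isotopy fixes p, as p is on the boundary, so F fixes q and induces phi; its inverse induces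
    psi. *)
Lemma handlebody_group_pi1 (R : realType) (S V : topologicalType) (p : S) (q : V)
    (i : pointed_map p q) (f : pointed_map p p) :
  surface_boundary R p -> handlebody_group R i f ->
  exists phi psi : {multiplicative pi1 R q -> pi1 R q},
    (forall x, phi (psi x) = x) /\
    (forall x : pi1 R p, pi1_map i (pi1_map f x) = phi (pi1_map i x)).
Proof.
move=> bp [_ [f' [F [[K [cK hK K0 K1]] [cF [F' [cF' FK F'K]]] Fi]]]].
have Kp t : K (t, p) = p by exact: (hK t).2.
have Fq : F q = q by rewrite -(pointed_map_base i) Fi -K1 Kp.
have F'q : F' q = q by rewrite -{1}Fq FK.
exists (pi1_map (PointedMap cF Fq)), (pi1_map (PointedMap cF' F'q)); split.
  exact: pi1_map_can.
move=> x; have [c ->] := loop_class_surj x; rewrite /= !pi1_mapE.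
(* Pushing the isotopy into V gives a based homotopy from i f c to i f' c = F i c. *)
apply/loop_classP; exists (fun u => i (K (u.1, c u.2))); split=> /=.
- apply: comp_cont; first exact: pointed_map_continuous.
  apply: comp_cont => //; apply: pair_cont; first exact: fst_cont.
  by apply: comp_cont; [exact: loop_continuous | exact: snd_cont].
- by move=> t; rewrite K0.
- by move=> t; rewrite K1 -Fi.
- by move=> s t ht; rewrite loop_out // Kp pointed_map_base.
Qed.

(** * The determinant formula and its triviality on the deeper Johnson filtration *)

Theorem theoremB (R : realType) (g : nat) (Sigma V : topologicalType)
    (p : Sigma) (q : V) (i : pointed_map p q) (o : R * R -> Sigma)
    (omega : H1 R p -> H1 R p -> int) (alpha beta : 'I_g -> pi1 R p) :
  (2 <= g)%N ->
  handlebody_pair R g i ->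
  surface_boundary R p ->
  open_embedding o ->
  intersection_form o omega ->
  free_basis (join_families alpha beta) ->
  symplectic_family omega alpha beta ->
  [set x : pi1 R p | pi1_map i x = 1%g] = normal_closure (range alpha) ->
  free_basis (fun k => pi1_map i (beta k)) ->
  (forall f : pointed_map p p,
     handlebody_group R i f -> johnson_filtration R 1 f ->
     \det (magnus_ab i beta f) =
       gr (lagrangian_trace i omega (johnson1 omega f)
             : GRing.to_multiplicative (H1 R q))) /\
  (forall k : nat, (2 <= k)%N -> forall f : pointed_map p p,
     handlebody_group R i f -> johnson_filtration R k f ->
     \det (magnus_ab i beta f) = 1).
Proof.
move=> _ _ bp _ [omega_bi _] fb sf kerE fb'.
have iota_alpha k : pi1_map i (alpha k) = 1%g.
  have : normal_closure (range alpha) (alpha k).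
    apply: generated_in; exists (alpha k); first by exists k.
    by exists 1%g => //; rewrite /conjg invg1 mul1g mulg1.
  by rewrite -kerE.
pose b k := pi1_map i (beta k).
(* Any classes [l j] of f(beta_j) beta_j^-1 compute the determinant: those given by tau_1 in the
   first claim, 0 in the second. *)
have detE (f : pointed_map p p) (l : 'I_g -> lie2 (H1 R p)) :
    handlebody_group R i f -> johnson_filtration R 1 f ->
    (forall j, gr2 (pi1_map f (beta j) * (beta j)^-1)%g (l j)) ->
    \det (magnus_ab i beta f) =
    gr (\sum_j tens_coef (foxab b) j (val (lie2_map (H1_map R i) (l j)))
       : GRing.to_multiplicative (H1 R q)).
  move=> hf f2 hl; have [phi [psi [phiK phiE]]] := handlebody_group_pi1 bp hf.
  have phi1 y : ab (phi y) = ab y.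
    have [x <-] := pi1_map_surj fb' y; rewrite -phiE -!(abel_mapE (pi1_map i)); congr abel_map.
    exact: (ab_eq (f2 x)).
  have hl' j : gr2 (phi (b j) * (b j)^-1)%g (lie2_map (H1_map R i) (l j)).
    by have := gr2_morph (pi1_map i) (hl j); rewrite gmulfM gmulf_inv /= phiE.
  apply: etrans (det_fox fb' phiK phi1 hl').
  apply: (congr1 (@determinant _ g)); apply/matrixP => j k.
  by rewrite [LHS]mxE [RHS]mxE [in LHS]mxE phiE.
split=> [f hf f2|k k2 f hf fk].
  have [phi [psi [phiK phiE]]] := handlebody_group_pi1 bp hf.
  have TP x : gr2 (pi1_map f x * x^-1)%g (tens_omega omega (ab x) (johnson1 omega f)).
    have [T hT] := johnson1_exists omega_bi fb sf f2.
    move: x; apply: (@xgetPex _ _ [set T | forall x : pi1 R p,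
      gr2 (pi1_map f x * x^-1)%g (tens_omega omega (ab x) T)]).
    by exists T.
  rewrite (detE f _ hf f2 (fun j => TP (beta j))); congr (gr _).
  apply/esym/(lagrangian_traceE omega_bi fb sf iota_alpha fb') => j.
  (* The image of tau_1(f)(alpha_j) in L_2(H') is a class of phi(1) 1^-1 = 1, hence zero. *)
  apply: (gr2_unique fb' (foxab_crossed fb') (foxab_basis fb')).
  have := gr2_morph (pi1_map i) (TP (alpha j)).
  by rewrite gmulfM gmulf_inv /= phiE iota_alpha gmulf_one mulgV.
have f2 : johnson_filtration R 1 f by move=> x; apply: lower_central_le (fk x); exact: ltnW.
rewrite (detE f (fun=> 0) hf f2) => [|j]; last first.
  (* For k >= 2 the element f(beta_j) beta_j^-1 lies in Gamma_3, so 0 is a class for it. *)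
  by apply: gr2_lower_central3; apply: lower_central_le (fk _).
rewrite big1 // => j _; rewrite (morphD0 (@lie2_mapD _ _ _)).
exact: (morphD0 (tens_coefD (foxab_crossed fb') j)).
Qed.
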